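(* Thompson's group $T$ is $\frac{3}{2}$-generated, that is, for every nontrivial $\alpha \in T$ there exists $\beta \in T$ such that $\langle \alpha, \beta \rangle = T$.
   Context: A group $G$ is $\frac32$-generated if every nontrivial element of $G$ is contained in a generating pair of $G$. Let $\mathbb{S}^1 = \mathbb{R}/\mathbb{Z}$. Thompson's group $T$ is the group (under composition) of piecewise linear homeomorphisms of $\mathbb{S}^1$ which preserve $\mathbb{Z}[\frac12]/\mathbb{Z}$ (the image of the dyadic rationals), have finitely many breakpoints, have all gradients equal to integral powers of two (in particular gradients are positive), and have all breakpoints in $\mathbb{Z}[\frac12]/\mathbb{Z}$. $\langle \alpha, \beta\rangle$ denotes the subgroup generated by $\alpha$ and $\beta$. *)

(* Defs.v *)
From HB Require Import structures.
From mathcomp Require Import all_boot all_order all_algebra.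
From mathcomp Require Import lra.
From mathcomp Require Import all_classical all_reals all_analysis.

Set Implicit Arguments.
Unset Strict Implicit.
Unset Printing Implicit Defensive.

Import Order.TTheory GRing.Theory Num.Theory.
Import numFieldNormedType.Exports.

Local Open Scope classical_set_scope.
Local Open Scope ring_scope.
Local Open Scope quotient_scope.

Definition subgroup_closed (G : groupType) (H : set G) : Prop :=
  [/\ H 1%g, (forall x y, H x -> H y -> H (x * y)%g)
    & forall x, H x -> H (x^-1)%g].

Definition generated (G : groupType) (A : set G) : set G :=
  smallest (@subgroup_closed G) A.

Definition three_halves_generated (G : groupType) : Prop :=
  forall x : G, x <> 1%g -> exists y : G, generated [set x; y] = [set: G].

Definition homeomorphism (X Y : topologicalType) (f : X -> Y) : Prop :=
  continuous f /\
  exists g : Y -> X, [/\ continuous g, cancel f g & cancel g f].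

(* The subgroup Z of R: [Num.int_num_subdef] is the predicate underlying the
   qualifier [Num.int], and the one carrying the closure instances. *)
Definition integers (R : realType) : zmodClosed R :=
  GRing.ZmodClosed.clone R (@Num.int_num_subdef R) _.

Definition circle (R : realType) : Type :=
  quotient_topology (Quotient.quot (integers R)).

Section Circle.
Context {R : realType}.

HB.instance Definition _ := Topological.on (circle R).
HB.instance Definition _ := Quotient.on (circle R).
HB.instance Definition _ := GRing.Zmodule.copy (circle R)
  (Quotient.quot (integers R)).

End Circle.

Definition proj (R : realType) (x : R) : circle R := \pi_(circle R) x.

Definition dyadic (R : realType) : set (circle R) :=
  [set p | exists (m : int) (n : nat), p = proj (m%:~R / 2 ^+ n)].

(* The addition is that of R/Z, so no lift of f to R is needed; a is the
   gradient of f at p, unique by [linear_near_uniq] below. *)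
Definition linear_near (R : realType) (f : circle R -> circle R)
    (p : circle R) (a : R) : Prop :=
  \forall t \near (0 : R), f (p + proj t) = f p + proj (a * t).

Definition breakpoints (R : realType) (f : circle R -> circle R) :
    set (circle R) :=
  [set p | ~ exists a : R, linear_near f p a].

(* There is no separate piecewise linearity clause: a continuous map that is
   linear near all but finitely many points has constant gradient on each of
   the finitely many complementary arcs. *)
Record thompson_map (R : realType) (f : circle R -> circle R) : Prop :=
  ThompsonMap {
    thompson_homeo : homeomorphism f;
    thompson_dyadic : f @` @dyadic R = @dyadic R;
    thompson_finite : finite_set (breakpoints f);
    thompson_gradient : forall (p : circle R) (a : R),
      linear_near f p a -> exists k : int, a = 2 ^ k;
    thompson_breakpoints : breakpoints f `<=` @dyadic R }.

Definition thompsonT (R : realType) : Type :=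
  set_type [set f : circle R -> circle R | thompson_map f].

Section ThompsonGroup.
Context {R : realType}.
Implicit Types (f g : circle R -> circle R) (p : circle R) (a b : R).

Lemma projD (x y : R) : proj (x + y) = proj x + proj y.
Proof. by rewrite /proj; exact: (raddfD (\pi_(Quotient.quot (integers R)))). Qed.

Lemma proj0 : proj (0 : R) = 0.
Proof. by rewrite /proj; exact: (raddf0 (\pi_(Quotient.quot (integers R)))). Qed.

Lemma proj_small (x y : R) : `|x - y| < 1 -> proj x = proj y -> x = y.
Proof.
move=> xy1 xyE; have : x - y \in integers R.
  by rewrite Quotient.idealrBE; exact/eqP.
move=> /intrP[m xym]; move: xy1; rewrite xym -intr_norm.
rewrite (_ : 1 = 1%:~R)// ltr_int -[1]add0r ltzD1 normr_le0 => /eqP m0.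
by apply/eqP; rewrite -subr_eq0 xym m0.
Qed.

Lemma near0_scale a (P : set R) :
  (\forall t \near (0 : R), P t) -> \forall t \near (0 : R), P (a * t).
Proof.
move=> P0; have /(_ P) : (fun t : R => a * t) t @[t --> (0 : R)] --> (0 : R).
  rewrite -[X in _ --> X](mulr0 a); apply: cvgM; [exact: cvg_cst|exact: cvg_id].
by apply.
Qed.

Lemma near0_shift (P : set R) : (\forall t \near (0 : R), P t) ->
  \forall t \near (0 : R), \forall s \near (0 : R), P (t + s).
Proof.
move=> /near_join; apply: filterS => t Pt.
have /(_ P) : (fun s : R => t + s) s @[s --> (0 : R)] --> t.
  rewrite -[X in _ --> X](addr0 t); apply: cvgD; [exact: cvg_cst|exact: cvg_id].
by apply.
Qed.

Lemma linear_near_uniq f p a b :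
  linear_near f p a -> linear_near f p b -> a = b.
Proof.
move=> fa fb; apply: contrapT => /eqP; rewrite -subr_eq0 => ab0.
have small : \forall t \near (0 : R), `|(a - b) * t| < 1.
  apply: (@near0_scale _ [set t : R | `|t| < 1]).
  by apply: (@nbhs0_lt R R^o).
have : \forall t \near (0 : R), t = 0.
  near=> t; apply: (mulfI ab0); rewrite mulr0.
  apply/eqP; rewrite mulrBl subr_eq0; apply/eqP/proj_small; first by rewrite -mulrBl; near: t.
  apply: (addrI (f p)); transitivity (f (p + proj t)); first symmetry; near: t.
    exact: fa.
  exact: fb.
move=> /nbhs_ballP[e /= e0]/(_ (e / 2)); rewrite /ball/= sub0r normrN.
rewrite gtr0_norm ?divr_gt0// gtr_pMr// invf_lt1// ltr1n => /(_ isT)/eqP.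
by rewrite gt_eqF// divr_gt0.
Unshelve. all: by end_near. Qed.

Lemma linear_near_shift f p a : linear_near f p a ->
  \forall t \near (0 : R), linear_near f (p + proj t) a.
Proof.
move=> fa; have := near0_shift fa; apply: filterS2 fa => t ft.
apply: filterS => s fts.
by rewrite -addrA -projD fts ft mulrDr projD addrA.
Qed.

Lemma linear_near_comp f g p a b :
  linear_near g p a -> linear_near f (g p) b -> linear_near (f \o g) p (b * a).
Proof.
move=> ga /(near0_scale a); apply: filterS2 ga => t /= -> ->.
by rewrite mulrA.
Qed.

Lemma linear_near_inv f g p a : cancel f g -> a != 0 ->
  linear_near f p a -> linear_near g (f p) a^-1.
Proof.
move=> fK a0 /(near0_scale a^-1); apply: filterS => t.
by rewrite mulrA divff// mul1r => <-; rewrite !fK.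
Qed.

Lemma near_avoid (B : set (circle R)) p (P : set R) : finite_set B ->
  (\forall t \near (0 : R), P t) -> exists2 t, P t & ~ B (p + proj t).
Proof.
move=> finB /nbhs_ballP[e /= e0 eP]; apply: contrapT => noP.
pose d := Num.min e 1; have d0 : 0 < d by rewrite lt_min e0 ltr01.
have d1 : d <= 1 by rewrite ge_min lexx orbT.
have dP x : 0 < x < d -> P x.
  move=> /andP[x0 xd]; apply: eP; rewrite /ball/= sub0r normrN gtr0_norm//.
  by rewrite (lt_le_trans xd)// ge_min lexx.
pose u (n : nat) : R := d / n.+2%:R.
have u0d n : 0 < u n < d.
  by rewrite divr_gt0//= gtr_pMr// invf_lt1// ltr1n.
pose v n := p + proj (u n).
have vinj : {in v @^-1` B &, injective v}.
  move=> m n _ _ /addrI/proj_small uE.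
  have /uE : `|u m - u n| < 1.
    have /andP[m0 md] := u0d m; have /andP[n0 nd] := u0d n.
    by rewrite ltr_norml; apply/andP; split; lra.
  by move=> /(mulfI (lt0r_neq0 d0))/invr_inj/eqP; rewrite eqr_nat => /eqP[].
have vB : v @^-1` B = setT.
  rewrite -subTset => n _ /=; apply: contrapT => nB.
  by apply: noP; exists (u n); [exact/dP/u0d|].
by apply: infinite_nat; rewrite -vB; exact: finite_preimage.
Qed.

Lemma linear_near_id p : linear_near id p 1.
Proof. by apply: filterS filterT => t _; rewrite mul1r. Qed.

Lemma thompson_map_id : thompson_map (@id (circle R)).
Proof.
have noB : breakpoints (@id (circle R)) = set0.
  by rewrite -subset0 => p; apply; exists 1; exact: linear_near_id.
split.
- by split; [move=> x; exact: cvg_id|exists id; split => // x; exact: cvg_id].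
- exact: image_id.
- by rewrite noB; exact: finite_set0.
- by move=> p a ap; exists 0; exact: linear_near_uniq ap (linear_near_id p).
- by rewrite noB.
Qed.

Lemma breakpoints_comp f g :
  breakpoints (f \o g) `<=` breakpoints g `|` g @^-1` breakpoints f.
Proof.
move=> p fgp; apply: contrapT => /not_orP[/contrapT[a ga] /contrapT[b fb]].
by apply: fgp; exists (b * a); exact: linear_near_comp.
Qed.

Lemma thompson_map_comp f g :
  thompson_map f -> thompson_map g -> thompson_map (f \o g).
Proof.
move=> [[cf [f' [cf' fK f'K]]] df finf gradf bpf].
move=> [[cg [g' [cg' gK g'K]]] dg fing gradg bpg].
have finfg : finite_set (breakpoints g `|` g @^-1` breakpoints f).
  rewrite finite_setU; split => //; apply: finite_preimage finf.
  by move=> x y _ _; exact: (can_inj gK).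
split.
- split; first by move=> x; apply: continuous_comp; [exact: cg|exact: cf].
  exists (g' \o f'); split; last 2 first.
  + exact: can_comp.
  + exact: can_comp.
  by move=> x; apply: continuous_comp; [exact: cf'|exact: cg'].
- by rewrite -image_comp dg df.
- exact: sub_finite_set (@breakpoints_comp f g) finfg.
- move=> p a /linear_near_shift /(near_avoid p finfg)[t fgt].
  move=> /not_orP[/contrapT[b gb] /contrapT[c fc]].
  have -> := linear_near_uniq fgt (linear_near_comp gb fc).
  have [k ->] := gradg _ _ gb; have [l ->] := gradf _ _ fc.
  by exists (l + k); rewrite expfzDr.
- move=> p /breakpoints_comp[/bpg//|/bpf].
  by rewrite -[in X in X -> _]dg => -[q dq /(can_inj gK) <-].
Qed.

Lemma breakpoints_inv f g : thompson_map f -> cancel f g -> cancel g f ->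
  breakpoints g `<=` g @^-1` breakpoints f.
Proof.
move=> Tf fK gK q gq [a fa]; apply: gq; exists a^-1.
rewrite -[q]gK; apply: linear_near_inv => //.
by have [k ->] := thompson_gradient Tf fa; rewrite expfz_neq0.
Qed.

Lemma thompson_map_inv f g :
  thompson_map f -> cancel f g -> cancel g f -> thompson_map g.
Proof.
move=> Tf fK gK; have [[cf [f' [cf' f'K _]]] df finf gradf bpf] := Tf.
have f'E : f' = g by apply/funext => x; rewrite -[in LHS](gK x) f'K.
rewrite {}f'E {f'K} in cf'.
have fing : finite_set (g @^-1` breakpoints f).
  by apply: finite_preimage finf => x y _ _; exact: (can_inj gK).
split.
- by split => //; exists f.
- by rewrite -{1}df image_comp (_ : g \o f = id) ?image_id//; exact/funext.
- exact: sub_finite_set (breakpoints_inv Tf fK gK) fing.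
- move=> p a /linear_near_shift /(near_avoid p fing)[t gt /contrapT[b fb]].
  have [k bE] := gradf _ _ fb; have b0 : b != 0 by rewrite bE expfz_neq0.
  have := linear_near_inv fK b0 fb; rewrite gK => /(linear_near_uniq gt) ->.
  by exists (- k); rewrite bE invr_expz.
- move=> q /(breakpoints_inv Tf fK gK)/bpf dq; rewrite -(gK q) -df.
  by exists (g q).
Qed.

Implicit Types x y z : thompsonT R.

Lemma thompsonTP x : thompson_map (val x). Proof. exact: set_mem (valP x). Qed.

Lemma thompsonT_inv_ex x :
  exists g, cancel (val x) g /\ cancel g (val x).
Proof. by have [_ [g [_ ? ?]]] := thompson_homeo (thompsonTP x); exists g. Qed.

Definition thompson_fun_inv x : circle R -> circle R :=
  projT1 (cid (thompsonT_inv_ex x)).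

Lemma thompson_fun_invP x :
  cancel (val x) (thompson_fun_inv x) /\ cancel (thompson_fun_inv x) (val x).
Proof. by rewrite /thompson_fun_inv; case: cid. Qed.

Definition thompson_one : thompsonT R :=
  SigSub (mem_set thompson_map_id).

Definition thompson_mul x y : thompsonT R :=
  SigSub (mem_set (thompson_map_comp (thompsonTP x) (thompsonTP y))).

Definition thompson_inv x : thompsonT R :=
  SigSub (mem_set (thompson_map_inv (thompsonTP x)
    (thompson_fun_invP x).1 (thompson_fun_invP x).2)).

Lemma thompson_mulA : associative thompson_mul.
Proof. by move=> x y z; exact: val_inj. Qed.

Lemma thompson_mul1 : left_id thompson_one thompson_mul.
Proof. by move=> x; exact: val_inj. Qed.

Lemma thompson_mulr1 : right_id thompson_one thompson_mul.
Proof. by move=> x; exact: val_inj. Qed.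

Lemma thompson_mulV : left_inverse thompson_one thompson_inv thompson_mul.
Proof.
by move=> x; apply/val_inj/funext => p /=; exact: (thompson_fun_invP x).1.
Qed.

Lemma thompson_mulrV : right_inverse thompson_one thompson_inv thompson_mul.
Proof.
by move=> x; apply/val_inj/funext => p /=; exact: (thompson_fun_invP x).2.
Qed.

HB.instance Definition _ := Choice.on (thompsonT R).
HB.instance Definition _ := isGroup.Build (thompsonT R)
  thompson_mulA thompson_mul1 thompson_mulr1 thompson_mulV thompson_mulrV.

End ThompsonGroup.

(* Main.v *)
(** Maps in T lift to homeomorphisms of the line that commute with x |-> x + 1,
    and Thompson's group F is realised as the group of dyadic piecewise linear
    homeomorphisms of the line that are integer translations near -oo and near
    +oo.  F is generated by the unit translation and one map doubling [0, 1].

    Let H be a subgroup of T and let g1, g2 in H act on an arc K like a pair of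
    generators of F and have disjoint supports outside K.  A map supported
    inside K is a word in the generators whose exponent sums vanish, so the
    same word in g1, g2 is trivial outside K: hence H contains every map
    supported inside K.  If moreover H moves each point into K, then gluing
    along overlapping arcs gives H = T.

    Given alpha, it remains to find beta providing g1, g2 and moving every
    point into K.  F is generated by two bumps with overlapping supports that
    are conjugate to each other.  If alpha^2 is not 1, choose beta exchanging
    two disjoint arcs A1 and A2, with beta^2 supported in their union, such
    that alpha(A1) overlaps A2; then beta^2 and its conjugate by alpha do.  If
    alpha^2 = 1, choose beta permuting three disjoint arcs cyclically, with
    beta^3 supported in their union, and take the conjugates of beta^3 by
    alpha and by beta alpha. *)

(* The two bumps come as powers of beta, so each moves several arcs: with two arcs, beta^2 moves A1
   and A2, and its conjugate by alpha moves alpha(A1) and alpha(A2). Exactly one crossing, inside K,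
   is wanted; any other breaks the disjointness of the supports outside K. For an involution, alpha
   carries an overlap of alpha(A1) with A2 to one of A1 with alpha(A2), so crossings come in pairs;
   hence the third arc and the further conjugation by beta, which destroys this symmetry. If alpha^2
   is not 1, some x has x, alpha x, alpha^2 x distinct and in this cyclic order, for alpha or for
   its inverse, and that leaves room for a single crossing.

   The exponent sums are visible on the line: the translations near -oo and near +oo give two
   homomorphisms from F to the integers, which send the two bumps to (0, 1) and (1, 0). A point
   outside K is moved by at most one of g1 and g2, so a word acts on it as a power of that one, with
   the exponent sum as exponent. *)
From mathcomp Require Import all_boot all_order all_algebra.
From mathcomp Require Import ring lra.
From mathcomp Require Import all_classical all_reals all_analysis.
Require Import Defs.

Set Implicit Arguments.
Unset Strict Implicit.
Unset Printing Implicit Defensive.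

Import Order.TTheory GRing.Theory Num.Theory.

Local Open Scope ring_scope.

(** * Dyadic numbers and germs *)

(* [lra] reifies the whole context, which is slow on large ones. *)
Ltac light_lra := repeat match goal with H : forall _, _ |- _ => clear H end; lra.

Ltac order_lra :=
  repeat match goal with
  | H : ?T |- _ => lazymatch T with is_true _ => fail | _ => clear H end
  end; lra.

Section Dyadics.
Context {R : realType}.
Implicit Types (a b c d e x y t : R) (F G : R -> R).

Definition dyad x := exists (m : int) (n : nat), x = m%:~R / 2 ^+ n.
Definition pow2 a := exists k : int, a = 2 ^ k.

Lemma pow2_gt0 a : pow2 a -> 0 < a.
Proof. by move=> [k ->]; exact: exprz_gt0. Qed.

Lemma pow2M a b : pow2 a -> pow2 b -> pow2 (a * b).
Proof. by move=> [k ->] [l ->]; exists (k + l); rewrite expfzDr// pnatr_eq0. Qed.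

Lemma pow2V a : pow2 a -> pow2 a^-1.
Proof. by move=> [k ->]; exists (- k); rewrite invr_expz. Qed.

Lemma pow2X n : pow2 (2 ^+ n).
Proof. by exists n. Qed.

Lemma pow21 : pow2 1. Proof. by exists 0. Qed.
Lemma pow22 : pow2 2. Proof. by exists 1. Qed.
Lemma pow2h : pow2 2^-1. Proof. exact: pow2V pow22. Qed.

Lemma exp2_gt0 n : 0 < 2 ^+ n :> R.
Proof. by rewrite exprn_gt0. Qed.

Lemma exp2_neq0 n : 2 ^+ n != 0 :> R.
Proof. by rewrite gt_eqF// exp2_gt0. Qed.

Lemma dyad_int (m : int) : dyad m%:~R.
Proof. by exists m, 0%N; rewrite expr0 divr1. Qed.

Lemma dyad_nat (m : nat) : dyad m%:R.
Proof. exact: (dyad_int m). Qed.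

Lemma dyad0 : dyad 0. Proof. exact: (dyad_int 0). Qed.
Lemma dyad1 : dyad 1. Proof. exact: (dyad_int 1). Qed.

Lemma dyadD x y : dyad x -> dyad y -> dyad (x + y).
Proof.
move=> [m [n ->]] [m' [n' ->]].
exists (m * 2 ^+ n' + m' * 2 ^+ n), (n + n')%N.
rewrite intrD !intrM !rmorphXn/= exprD.
by field; rewrite !exp2_neq0.
Qed.

Lemma dyadN x : dyad x -> dyad (- x).
Proof. by move=> [m [n ->]]; exists (- m), n; rewrite rmorphN/= mulNr. Qed.

Lemma dyadB x y : dyad x -> dyad y -> dyad (x - y).
Proof. by move=> dx dy; apply: dyadD => //; exact: dyadN. Qed.

Lemma dyadM x y : dyad x -> dyad y -> dyad (x * y).
Proof.
move=> [m [n ->]] [m' [n' ->]]; exists (m * m'), (n + n')%N.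
rewrite intrM exprD; by field; rewrite !exp2_neq0.
Qed.

Lemma pow2_dyad a : pow2 a -> dyad a.
Proof.
move=> [[n|n] ->]; first by exists (2 ^+ n), 0%N; rewrite rmorphXn/= expr0 divr1.
by exists 1, n.+1; rewrite NegzE -exprnN div1r.
Qed.

Lemma dyad_half : dyad 2^-1. Proof. exact: pow2_dyad pow2h. Qed.

Lemma dyad_aff a c x : pow2 a -> dyad c -> dyad (a * x + c) <-> dyad x.
Proof.
move=> pa dc; split=> [h|dx]; last exact: dyadD (dyadM (pow2_dyad pa) dx) dc.
have -> : x = a^-1 * (a * x + c - c).
  by rewrite addrK mulKf// gt_eqF// pow2_gt0.
by apply: dyadM; [exact/pow2_dyad/pow2V|exact: dyadB].
Qed.

Lemma exp2_small e : 0 < e -> exists n, (2 ^+ n)^-1 < e.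
Proof.
move=> e0; exists (Num.truncn e^-1).+1.
rewrite -[ltRHS]invrK ltf_pV2 ?posrE ?invr_gt0 ?exp2_gt0//.
apply: lt_trans (truncnS_gt _) _.
by rewrite -natrX ltr_nat ltn_expl.
Qed.

Lemma dyad_dense x y : x < y -> exists2 d, dyad d & x < d < y.
Proof.
rewrite -subr_gt0 => /exp2_small[n ny].
exists ((Num.floor (x * 2 ^+ n) + 1)%:~R / 2 ^+ n); first by exists (Num.floor (x * 2 ^+ n) + 1), n.
have /andP[f1 f2] := floor_itv (x * 2 ^+ n).
rewrite ltr_pdivlMr ?exp2_gt0// f2/= ltr_pdivrMr ?exp2_gt0//.
rewrite intrD; apply: (le_lt_trans (lerD f1 (lexx _))).
rewrite -ltrBrDl -mulrBl -ltr_pdivrMr ?exp2_gt0//.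
by rewrite div1r.
Qed.

(* The last clause allows breakpoints at dyadic numbers only; this is not
   automatic, as 4 y - 1 and y agree at 1/3. *)
Definition germ F x := exists e a c b d,
  [/\ 0 < e, pow2 a /\ dyad c, pow2 b /\ dyad d,
    (forall y, x - e < y <= x -> F y = a * y + c) /\
    (forall y, x <= y < x + e -> F y = b * y + d)
  & dyad x \/ (a = b /\ c = d)].

Lemma germ_dyad F x : germ F x -> dyad (F x) <-> dyad x.
Proof.
move=> [e [a [c [b [d [e0 [pa dc] _ [Fl _] _]]]]]].
rewrite Fl; first exact: dyad_aff.
by apply/andP; split; lra.
Qed.

Lemma germ_comp F G x : germ G x -> germ F (G x) -> germ (F \o G) x.
Proof.
move=> Gx; have dG := germ_dyad Gx; move: Gx.
move=> [e1 [a1 [c1 [b1 [d1 [e10 [pa1 dc1] [pb1 dd1] [Gl Gr] Gx]]]]]].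
move=> [e2 [a2 [c2 [b2 [d2 [e20 [pa2 dc2] [pb2 dd2] [Fl Fr] Fx]]]]]].
have a10 := pow2_gt0 pa1; have b10 := pow2_gt0 pb1.
exists (Num.min e1 (Num.min (e2 / a1) (e2 / b1))), (a2 * a1), (a2 * c1 + c2), (b2 * b1), (b2 * d1 + d2).
have Gxl : G x = a1 * x + c1 by apply: Gl; apply/andP; split; lra.
have Gxr : G x = b1 * x + d1 by apply: Gr; apply/andP; split; lra.
split.
- by rewrite !lt_min e10 !divr_gt0.
- by split; [exact: pow2M|apply: dyadD => //; apply: dyadM => //; exact: pow2_dyad].
- by split; [exact: pow2M|apply: dyadD => //; apply: dyadM => //; exact: pow2_dyad].
- split=> y /andP[y1 y2] /=.
  + have ye1 : x - y < e1 by apply: (@lt_le_trans _ _ (Num.min e1 (Num.min (e2 / a1) (e2 / b1)))); [lra|rewrite ge_min lexx].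
    have ye2 : x - y < e2 / a1.
      by apply: (@lt_le_trans _ _ (Num.min e1 (Num.min (e2 / a1) (e2 / b1)))); [lra|rewrite !ge_min lexx orbT].
    rewrite Gl; last by apply/andP; split; lra.
    rewrite ltr_pdivlMr// in ye2.
    have h : 0 <= (x - y) * a1 by rewrite mulr_ge0//; lra.
    rewrite Fl; last by rewrite Gxl; apply/andP; split; lra.
    by rewrite mulrDr mulrA addrA.
  + have ye1 : y - x < e1 by apply: (@lt_le_trans _ _ (Num.min e1 (Num.min (e2 / a1) (e2 / b1)))); [lra|rewrite ge_min lexx].
    have ye2 : y - x < e2 / b1.
      by apply: (@lt_le_trans _ _ (Num.min e1 (Num.min (e2 / a1) (e2 / b1)))); [lra|rewrite !ge_min lexx !orbT].
    rewrite Gr; last by apply/andP; split; lra.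
    rewrite ltr_pdivlMr// in ye2.
    have h : 0 <= (y - x) * b1 by rewrite mulr_ge0//; lra.
    rewrite Fr; last by rewrite Gxr; apply/andP; split; lra.
    by rewrite mulrDr mulrA addrA.
(* At a non-dyadic x the point G x is not dyadic either, so both germs consist of a single affine
   piece. *)
- have [dx|ndx] := pselect (dyad x); [by left|right].
  case: Gx => // -[<- <-]; case: Fx => [|[<- <-]//].
  by move=> /dG.
Qed.

Lemma germ_aff a c x : pow2 a -> dyad c -> germ (fun y => a * y + c) x.
Proof. by move=> pa dc; exists 1, a, c, a, c; split => //; right. Qed.

Lemma germ_near F G e x : 0 < e -> (forall y, x - e < y < x + e -> F y = G y) ->
  germ F x -> germ G x.
Proof.
move=> e0 FG [e1 [a [c [b [d [e10 pa pb [Fl Fr] Fx]]]]]].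
exists (Num.min e e1), a, c, b, d; split => //; first by rewrite lt_min e0.
have m1 : Num.min e e1 <= e by rewrite ge_min lexx.
have m2 : Num.min e e1 <= e1 by rewrite ge_min lexx orbT.
split=> y /andP[y1 y2]; rewrite -FG.
- by apply: Fl; apply/andP; split; lra.
- by apply/andP; split; lra.
- by apply: Fr; apply/andP; split; lra.
- by apply/andP; split; lra.
Qed.

Lemma germ_glue F G H e x : 0 < e -> dyad x -> germ F x -> germ G x ->
  (forall y, x - e < y <= x -> H y = F y) ->
  (forall y, x <= y < x + e -> H y = G y) -> germ H x.
Proof.
move=> e0 dx [e1 [a1 [c1 [b1 [d1 [e10 pa1 _ [Fl _] _]]]]]].
move=> [e2 [a2 [c2 [b2 [d2 [e20 _ pb2 [_ Gr] _]]]]]] HF HG.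
exists (Num.min e (Num.min e1 e2)), a1, c1, b2, d2; split => //; last by left.
  by rewrite !lt_min e0 e10.
have m1 : Num.min e (Num.min e1 e2) <= e by rewrite ge_min lexx.
have m2 : Num.min e (Num.min e1 e2) <= e1 by rewrite !ge_min lexx orbT.
have m3 : Num.min e (Num.min e1 e2) <= e2 by rewrite !ge_min lexx !orbT.
split=> y /andP[y1 y2].
- rewrite HF; last by apply/andP; split; lra.
  by apply: Fl; apply/andP; split; lra.
- rewrite HG; last by apply/andP; split; lra.
  by apply: Gr; apply/andP; split; lra.
Qed.

Lemma germ_inv F G x : cancel F G -> cancel G F -> {mono F : y z / y <= z} ->
  germ F x -> germ G (F x).
Proof.
move=> FK GK Fm Fg; have dF := germ_dyad Fg; move: Fg.
move=> [e [a [c [b [d [e0 [pa dc] [pb dd] [Fl Fr] Fx]]]]]].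
have a0 := pow2_gt0 pa; have b0 := pow2_gt0 pb.
have Fxl : F x = a * x + c by apply: Fl; apply/andP; split; lra.
have Fxr : F x = b * x + d by apply: Fr; apply/andP; split; lra.
exists (Num.min (e * a) (e * b)), a^-1, (- (a^-1 * c)), b^-1, (- (b^-1 * d)).
have m1 : Num.min (e * a) (e * b) <= e * a by rewrite ge_min lexx.
have m2 : Num.min (e * a) (e * b) <= e * b by rewrite !ge_min lexx orbT.
split.
- by rewrite lt_min !mulr_gt0.
- by split; [exact: pow2V|apply/dyadN/dyadM => //; exact/pow2_dyad/pow2V].
- by split; [exact: pow2V|apply/dyadN/dyadM => //; exact/pow2_dyad/pow2V].
- split=> y /andP[y1 y2]; rewrite -mulrBr; apply: (can_inj FK); rewrite GK.
  + set z := a^-1 * (y - c); have yE : y = a * z + c by rewrite /z mulVKf ?subrK// gt_eqF.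
    rewrite Fl// -?yE//.
    have h1 : 0 <= a * (x - z) by lra.
    have h2 : 0 < a * (z - (x - e)) by lra.
    by rewrite pmulr_rge0// in h1; rewrite pmulr_rgt0// in h2; apply/andP; split; lra.
  + set z := b^-1 * (y - d); have yE : y = b * z + d by rewrite /z mulVKf ?subrK// gt_eqF.
    rewrite Fr// -?yE//.
    have h1 : 0 <= b * (z - x) by lra.
    have h2 : 0 < b * (x + e - z) by lra.
    by rewrite pmulr_rge0// in h1; rewrite pmulr_rgt0// in h2; apply/andP; split; lra.
- by case: Fx => [dx|[-> ->]]; [left; apply/dF|right].
Qed.

(* Unlike with [leP], case analysis on these disjunctions does not search the
   goal for comparisons to rewrite, which is slow on large goals. *)
Lemma le_or_lt x y : x <= y \/ y < x.
Proof. by case: leP; auto. Qed.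

Lemma lt_or_le x y : x < y \/ y <= x.
Proof. by case: leP; auto. Qed.

(** Continuous induction, through the supremum of the points that satisfy [A]. The step goes from x
    to y across s in one go, so it serves both to reach the supremum and to pass beyond it. *)
Lemma real_ind (A : R -> Prop) a b : a <= b -> A a ->
  (forall s, a <= s <= b -> exists2 e, 0 < e &
     forall x y, a <= x -> s - e < x -> x <= y -> y < s + e -> y <= b -> A x -> A y) ->
  A b.
Proof.
move=> ab Aa step; pose S : set R := [set x | a <= x <= b /\ A x]%classic.
have Sb : has_sup S.
  by split; [exists a; split => //; rewrite lexx|exists b => x [/andP[]]].
have supb : sup S <= b.
  by apply: ge_sup; [exact: Sb.1|move=> x [/andP[]]].
have supa : a <= sup S.
  by apply: ub_le_sup; [exact: Sb.2|split => //; rewrite lexx].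
have [|e e0 st] := step (sup S); first by rewrite supa.
have [x [/andP[ax xb] Ax] xs] := sup_adherent e0 Sb.
have xsup : x <= sup S by apply: ub_le_sup; [exact: Sb.2|split => //; rewrite ax].
have [sb|bs] := ltP (sup S) b; last by apply: (st x) => //; lra.
have [y [/andP[y1 y2] y3]] : exists y, sup S < y <= b /\ y < sup S + e.
  exists (Num.min b (sup S + e / 2)); rewrite lt_min sb ge_min lexx gt_min /=.
  by split; [lra|apply/orP; right; lra].
have Ay : A y by apply: (st x) => //; lra.
suff : y <= sup S by lra.
by apply: ub_le_sup; [exact: Sb.2|split => //; apply/andP; split; lra].
Qed.

End Dyadics.

(** * Dyadic piecewise linear homeomorphisms of the line *)

Section PLMaps.
Context {R : realType}.
Implicit Types (a b c d e x y t : R).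

(** [germ] is a condition at each single point; that a bounded interval has finitely many pieces
    comes from compactness, in [pl_level]. The inverse is a field, so that inverses, composites and
    glued maps are all given by formulas. *)
Record pl := PL {
  plf :> R -> R;
  pli : R -> R;
  plK : cancel plf pli;
  pliK : cancel pli plf;
  pl_mono : {mono plf : x y / x <= y};
  pl_germ : forall x, germ plf x }.

Implicit Types F G : pl.

Lemma plS F : {mono F : x y / x < y}.
Proof. exact: leW_mono (pl_mono F). Qed.

Lemma pl_dyad F x : dyad (F x) <-> dyad x.
Proof. exact: germ_dyad (pl_germ F x). Qed.

Lemma pl_inj F : injective F.
Proof. exact: can_inj (plK F). Qed.

Program Definition plinv F : pl := @PL (pli F) F (pliK F) (plK F) _ _.
Next Obligation. by move=> F x y; rewrite -(pl_mono F) !pliK. Qed.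
Next Obligation.
by move=> F x; rewrite -[x](pliK F); apply: germ_inv (plK F) (pliK F) (pl_mono F) (pl_germ F _).
Qed.

Program Definition plcomp F G : pl := @PL (F \o G) (pli G \o pli F) _ _ _ _.
Next Obligation. by move=> F G x /=; rewrite !plK. Qed.
Next Obligation. by move=> F G x /=; rewrite !pliK. Qed.
Next Obligation. by move=> F G x y /=; rewrite !pl_mono. Qed.
Next Obligation. by move=> F G x; apply: germ_comp; exact: pl_germ. Qed.

Program Definition plaff a c (pa : pow2 a) (dc : dyad c) : pl :=
  @PL (fun y => a * y + c) (fun y => a^-1 * (y - c)) _ _ _ _.
Next Obligation. by move=> a c pa dc x; rewrite addrK mulKf// gt_eqF ?pow2_gt0. Qed.
Next Obligation. by move=> a c pa dc x; rewrite mulVKf ?subrK// gt_eqF ?pow2_gt0. Qed.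
Next Obligation. by move=> a c pa dc x y; rewrite lerD2r ler_pM2l// pow2_gt0. Qed.
Next Obligation. by move=> a c pa dc x; exact: germ_aff. Qed.

Definition plid : pl := plaff pow21 dyad0.

Lemma plidE x : plid x = x.
Proof. by rewrite /= mul1r addr0. Qed.

Definition plsh c (dc : dyad c) : pl := plaff pow21 dc.

Lemma plshE c (dc : dyad c) x : plsh dc x = x + c.
Proof. by rewrite /= mul1r. Qed.

Lemma mono_of_incr (f : R -> R) : {homo f : x y / x < y} -> {mono f : x y / x <= y}.
Proof. by move=> h; apply: le_mono. Qed.

Section Glue.
Variables (F G : pl) (b : R).
Hypotheses (db : dyad b) (FG : F b = G b).

Let glue x := if x <= b then F x else G x.
Let gluei y := if y <= F b then pli F y else pli G y.

Program Definition plglue : pl := @PL glue gluei _ _ _ _.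
Next Obligation.
move=> x; rewrite /glue /gluei; case: (leP x b) => xb; first by rewrite pl_mono xb plK.
by rewrite FG pl_mono leNgt xb/= plK.
Qed.
Next Obligation.
move=> y; rewrite /glue /gluei; case: (leP y (F b)) => yb.
  by rewrite -(pl_mono F) pliK yb.
by rewrite -(pl_mono G) pliK -FG leNgt yb.
Qed.
Next Obligation.
apply: mono_of_incr => x y xy; rewrite /glue.
case: (leP x b) => xb; case: (leP y b) => yb; rewrite ?plS//; last by lra.
by apply: (@le_lt_trans _ _ (F b)); rewrite ?pl_mono// FG plS.
Qed.
Next Obligation.
move=> x; rewrite /glue; have [xb|bx|->] := ltgtP x b.
- apply: (@germ_near _ F _ (b - x)); [lra| |exact: pl_germ].
  by move=> y /andP[_ y1]; case: leP => //; lra.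
- apply: (@germ_near _ G _ (x - b)); [lra| |exact: pl_germ].
  by move=> y /andP[y1 _]; case: leP => //; lra.
- apply: (@germ_glue _ F G _ 1) => //; try exact: pl_germ.
    by move=> y /andP[_ y1]; rewrite y1.
  move=> y /andP[y1 _]; case: leP => // y2.
  by have -> : y = b by lra.
Qed.

Lemma plglueL x : x <= b -> plglue x = F x.
Proof. by rewrite /= /glue => ->. Qed.

Lemma plglueR x : b <= x -> plglue x = G x.
Proof.
rewrite /= /glue le_eqVlt => /orP[/eqP <-|bx]; first by rewrite lexx.
by rewrite leNgt bx.
Qed.

End Glue.

Lemma plglue_ex F G b : dyad b -> F b = G b ->
  exists H : pl, (forall x, x <= b -> H x = F x) /\ (forall x, b <= x -> H x = G x).
Proof.
by move=> db FG; exists (plglue db FG); split => x; [exact: plglueL|exact: plglueR].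
Qed.

(** Each step doubles the last unit cell [m, m + 1] of the image, which lengthens the image by
    one. *)
Lemma plpath1 (m : nat) : exists F : pl, F 0 = 0 /\ F 1 = m.+1%:R.
Proof.
elim: m => [|m [F [F0 F1]]]; first by exists plid; rewrite !plidE.
have dm := dyad_nat m : dyad (m%:R : R).
have [||H [HL HR]] := @plglue_ex plid (plaff pow22 (dyadN dm)) m%:R => //.
  by rewrite plidE/=; lra.
exists (plcomp H F); rewrite /= F0 F1 HL ?plidE// HR ?ler_nat//=; split => //.
by rewrite -(natr1 m.+1) -(natr1 m); lra.
Qed.

(** The length b - a is a positive integer over [2 ^+ n]: stretch [0, 1] to that integer, then
    scale. *)
Lemma plpath01 a b : dyad a -> dyad b -> a < b -> exists F : pl, F 0 = a /\ F 1 = b.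
Proof.
move=> da db; rewrite -subr_gt0 => ab; have [m [n mE]] := dyadB db da.
have m0 : 0 < m.
  by move: ab; rewrite mE pmulr_lgt0 ?invr_gt0 ?exp2_gt0// ltr0z.
case: m m0 mE => // -[//|m] _ mE.
have [F [F0 F1]] := plpath1 m.
exists (plcomp (plaff (pow2V (pow2X n)) da) F) => /=.
by rewrite F0 F1 mulr0 add0r mulrC -[m.+1%:R]/(m.+1%:~R) -mE subrK.
Qed.

Lemma plpath a b c d : dyad a -> dyad b -> dyad c -> dyad d -> a < b -> c < d ->
  exists F : pl, F a = c /\ F b = d.
Proof.
move=> da db dc dd ab cd.
have [F [F0 F1]] := plpath01 da db ab; have [G [G0 G1]] := plpath01 dc dd cd.
exists (plcomp G (plinv F)) => /=.
by rewrite -F0 -F1 !plK.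
Qed.

Lemma plpath_ext F b b' d' : dyad b -> dyad b' -> dyad d' -> b < b' -> F b < d' ->
  exists G : pl, (forall x, x <= b -> G x = F x) /\ G b' = d'.
Proof.
move=> db db' dd' bb Fb.
have [//|//|||//|//|H [Hb Hb']] := @plpath b b' (F b) d'; first by apply/pl_dyad.
  by [].
have [|H' [HL HR]] := @plglue_ex F H b db; first by rewrite Hb.
by exists H'; split => //; rewrite HR ?ltW.
Qed.

Fixpoint dpath (x y : R) (s : seq (R * R)) : Prop :=
  if s is p :: s' then [/\ dyad p.1, dyad p.2, x < p.1, y < p.2 & dpath p.1 p.2 s'] else True.

Lemma plpaths a b c d (s : seq (R * R)) : dyad a -> dyad c -> 
  dpath a c ((b, d) :: s) ->
  exists F : pl, F a = c /\ (forall p, List.In p ((b, d) :: s) -> F p.1 = p.2).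
Proof.
move=> da dc [/= db dd ab cd hs].
have [F [Fa Fb]] := plpath da db dc dd ab cd.
suff [G [GF Gs]] : exists G : pl, (forall x, x <= b -> G x = F x) /\ (forall p, List.In p s -> G p.1 = p.2).
  exists G; split; first by rewrite GF// ltW.
  by move=> p [<-|/Gs//]; rewrite GF /=.
rewrite -Fb in hs; have {}Fb : dyad (F b) by rewrite Fb.
clear ab cd Fa da dc dd a c d.
elim: s b F db Fb hs => [|[b' d'] s IH] b F db Fb /=; first by exists F.
move=> [db' dd' bb' Fd' hs].
have [G [GF Gb']] := plpath_ext db db' dd' bb' Fd'.
rewrite -Gb' in hs; have Gd : dyad (G b') by rewrite Gb'.
have [G' [G'G G's]] := IH _ _ db' Gd hs.
exists G'; split.
  by move=> x xb; rewrite G'G ?GF// (le_trans xb)// ltW.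
by move=> p [<-|/G's//] /=; rewrite G'G.
Qed.

End PLMaps.
Arguments pl R : clear implicits.

(** * Generators of Thompson's group F *)

Section Generation.
Context {R : realType}.
Implicit Types (a b c d e x y t : R) (F G : pl R).

Definition cell_aff (F : R -> R) (N : nat) (i : int) := exists a c,
  [/\ pow2 a, dyad c & forall t, i%:~R <= t * 2 ^+ N <= i%:~R + 1 -> F t = a * t + c].

Lemma int_between (i j : int) x : i%:~R < x < i%:~R + 1 -> x != j%:~R.
Proof.
move=> /andP[h1 h2]; apply/eqP => xj; move: h1 h2; rewrite xj ltr_int.
by rewrite -[1]/(1%:~R) -intrD ltr_int ltzD1 => h1; rewrite leNgt h1.
Qed.

Lemma exp2_le (m n : nat) : (m <= n)%N -> 2 ^+ m <= 2 ^+ n :> R.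
Proof. by move=> mn; rewrite ler_weXn2l// ler1n. Qed.

Lemma dyad_exp2 x : dyad x ->
  exists n, forall N, (n <= N)%N -> exists j : int, x * 2 ^+ N = j%:~R.
Proof.
move=> [m [n ->]]; exists n => N nN; exists (m * 2 ^+ (N - n)).
rewrite intrM rmorphXn/= -{1}(subnK nN) exprD; field.
exact: exp2_neq0.
Qed.

(** Compactness, by continuous induction on the right end of the interval. The claim is made for all
    levels from N on, so that bounds can be combined by taking a maximum. *)
Lemma pl_level F a b : a <= b -> exists N, forall N', (N <= N')%N ->
  forall i : int, a * 2 ^+ N' <= i%:~R -> i%:~R + 1 <= b * 2 ^+ N' ->
  cell_aff F N' i.
Proof.
move=> ab; apply: (@real_ind R (fun x => exists N, forall N', (N <= N')%N ->
  forall i : int, a * 2 ^+ N' <= i%:~R -> i%:~R + 1 <= x * 2 ^+ N' ->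
  cell_aff F N' i) a b ab).
  by exists 0%N => N' _ i h1 h2; exfalso; lra.
move=> s _; have [e [k1 [c1 [k2 [c2 [e0 [p1 d1] [p2 d2] [Fl Fr] Fs]]]]]] := pl_germ F s.
exists e => // x y ax sx xy ys yb [Nx hx].
(* From level [n1] on, cells are shorter than x - (s - e), so a cell not contained in [a, x] lies
   within reach of the germ at s. From level [n2] on, a dyadic s is a cell endpoint; at a non-dyadic
   s the germ has a single piece. *)
have [n1 n1e] : exists n, (2 ^+ n)^-1 < x - (s - e) by apply: exp2_small; lra.
have [n2 n2s] : exists n, forall N, (n <= N)%N -> dyad s -> exists j : int, s * 2 ^+ N = j%:~R.
  have [/dyad_exp2[n hn]|ns] := pselect (dyad s); last by exists 0%N => N _ /ns.
  by exists n => N /hn.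
exists (maxn Nx (maxn n1 n2)) => N; rewrite !geq_max => /and3P[NxN n1N n2N] i ai iy.
have N0 := exp2_gt0 N : 0 < 2 ^+ N :> R.
have [ix|xi] := leP (i%:~R + 1) (x * 2 ^+ N); first exact: hx.
have {}n1e : 1 < (x - (s - e)) * 2 ^+ N.
  rewrite -ltr_pdivrMr// div1r (le_lt_trans _ n1e)// lef_pV2 ?posrE ?exp2_gt0//.
  exact: exp2_le.
have cs t : i%:~R <= t * 2 ^+ N <= i%:~R + 1 -> s - e < t < s + e.
  move=> /andP[t1 t2]; rewrite -(ltr_pM2r N0) -[t < _](ltr_pM2r N0).
  have : y * 2 ^+ N < (s + e) * 2 ^+ N by rewrite ltr_pM2r.
  by move=> h; apply/andP; split; lra.
have [si|si] := leP (s * 2 ^+ N) i%:~R.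
  exists k2, c2; split => // t tt; apply: Fr; have /andP[_ ->] := cs _ tt.
  rewrite andbT -(ler_pM2r N0); move: tt => /andP[t1 _]; exact: le_trans t1.
have [si'|si'] := leP (i%:~R + 1) (s * 2 ^+ N).
  exists k1, c1; split => // t tt; apply: Fl; have /andP[-> _] := cs _ tt.
  rewrite -(ler_pM2r N0); move: tt => /andP[_ t1]; exact: le_trans si'.
case: Fs => [/(n2s _ n2N)[j sj]|[kE cE]].
  have /(int_between j)/eqP : i%:~R < s * 2 ^+ N < i%:~R + 1 by rewrite si.
  by [].
exists k1, c1; split => // t tt; have /andP[t1 t2] := cs _ tt.
have [ts|st] := leP t s; first by apply: Fl; rewrite t1.
by rewrite kE cE; apply: Fr; rewrite t2 ltW.
Qed.

Lemma plsplit_ex : exists V : pl R, [/\ forall t, t <= 0 -> V t = t,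
  forall t, 0 <= t <= 1 -> V t = 2 * t & forall t, 1 <= t -> V t = t + 1].
Proof.
have [|V1 [L1 R1]] := @plglue_ex R plid (plaff pow22 dyad0) 0 dyad0.
  by rewrite plidE/=; lra.
have [|V2 [L2 R2]] := @plglue_ex R V1 (plsh dyad1) 1 dyad1.
  by rewrite R1// plshE/=; lra.
exists V2; split => t.
- by move=> t0; rewrite L2 ?L1 ?plidE//; lra.
- by move=> /andP[t0 t1]; rewrite L2// R1//=; lra.
- by move=> t1; rewrite R2// plshE.
Qed.

Definition plsplit : pl R := projT1 (cid plsplit_ex).

Lemma plsplitE : [/\ forall t, t <= 0 -> plsplit t = t,
  forall t, 0 <= t <= 1 -> plsplit t = 2 * t &
  forall t, 1 <= t -> plsplit t = t + 1].
Proof. by rewrite /plsplit; case: cid. Qed.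

Definition plsplit_at (i : int) : pl R :=
  plcomp (plsh (dyad_int i)) (plcomp plsplit (plsh (dyad_int (- i)))).

Lemma plsplit_atE i : [/\ forall t, t <= i%:~R -> plsplit_at i t = t,
  forall t, i%:~R <= t <= i%:~R + 1 -> plsplit_at i t = 2 * t - i%:~R &
  forall t, i%:~R + 1 <= t -> plsplit_at i t = t + 1].
Proof.
have [h1 h2 h3] := plsplitE.
split=> t; rewrite [plsplit_at i t]/= !mul1r rmorphN/= => ti.
- by rewrite h1; lra.
- by rewrite h2; [lra|apply/andP; split; lra].
- by rewrite h3; lra.
Qed.

Definition ends F (m n : int) := exists M : nat,
  (forall t, t <= - M%:R -> F t = t + m%:~R) /\
  (forall t, M%:R <= t -> F t = t + n%:~R).

(** Integers go to integers and no unit cell shrinks, so the growth n - m of such a map with ends m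
    and n is a natural number on which to induct. *)
Definition expanding F := forall i : int, exists (k : nat) (j : int),
  forall t, i%:~R <= t <= i%:~R + 1 -> F t = 2 ^+ k * (t - i%:~R) + j%:~R.

Lemma expanding_le F : expanding F -> forall (i : int) (n : nat),
  F i%:~R + n%:R <= F (i%:~R + n%:R).
Proof.
move=> EF i; elim=> [|n IH]; first by rewrite !addr0.
have [k [j Fk]] := EF (i + n%:Z).
have -> : i%:~R + n.+1%:R = (i + n%:Z)%:~R + 1 :> R by rewrite -natr1 intrD addrA.
have h1 := Fk (i + n%:Z)%:~R; rewrite lexx lerDl ler01 in h1.
have h2 := Fk ((i + n%:Z)%:~R + 1); rewrite lexx lerDl ler01 in h2.
rewrite h2//; move: (IH); rewrite [i%:~R + n%:R](_ : _ = (i + n%:Z)%:~R) ?intrD//.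
rewrite -intrD h1// -natr1.
have : 2 ^+ 0 <= 2 ^+ k :> R by exact: exp2_le.
by rewrite expr0; lra.
Qed.

Lemma expanding_ends_le F m n : expanding F -> ends F m n -> m <= n.
Proof.
move=> EF [M [FL FR]]; have := expanding_le EF (- M%:Z) (M + M).
rewrite natrD rmorphN/= addKr FL// FR//.
by rewrite -(ler_int R); lra.
Qed.

(** Without a stretched cell F is a translation on each unit cell; neighbouring cells share an
    endpoint, so the translation near -oo propagates to the right. *)
Lemma expanding_shift F m n : expanding F -> ends F m n ->
  ~ (exists (i : int) (k : nat) (j : int),
       forall t, i%:~R <= t <= i%:~R + 1 -> F t = 2 ^+ k.+1 * (t - i%:~R) + j%:~R) ->
  forall t, F t = t + m%:~R.
Proof.
move=> EF [M [FM _]] nos.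
have Fsh (i : int) : exists j : int, forall t, i%:~R <= t <= i%:~R + 1 -> F t = t + j%:~R.
  have [[|k] [j Fi]] := EF i; last by exfalso; apply: nos; exists i, k, j.
  by exists (j - i) => t /Fi ->; rewrite intrB expr0; lra.
have Fl (l : nat) t : t <= - M%:R + l%:R -> F t = t + m%:~R.
  elim: l t => [|l IHl] t; first by rewrite addr0; exact: FM.
  move=> tl; have [tl'|tl'] := leP t (- M%:R + l%:R); first exact: IHl.
  have [j Fj] := Fsh (- M%:Z + l%:Z); move: Fj; rewrite intrD rmorphN/= => Fj.
  have := IHl _ (lexx _); rewrite Fj ?lexx ?lerDl ?ler01// => /addrI jm.
  by rewrite Fj ?jm// (ltW tl')/= (le_trans tl)// -addrA natr1.
move=> t; apply: (Fl (Num.truncn (t + M%:R)).+1).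
by rewrite addrC -lerBlDr opprK ltW// truncnS_gt.
Qed.

(** Undoing one doubling of the cell i leaves gradient 2 ^ k on the two cells [i, i + 1] and
    [i + 1, i + 2]. Everything further right has been pushed by one, whence n - 1. *)
Lemma expanding_reduce F m n (i : int) (k : nat) (j : int) : expanding F -> ends F m n ->
  (forall t, i%:~R <= t <= i%:~R + 1 -> F t = 2 ^+ k.+1 * (t - i%:~R) + j%:~R) ->
  exists G : pl R, [/\ forall x, F x = G (plsplit_at i x), expanding G & ends G m (n - 1)].
Proof.
move=> EF [M [FL FR]] Fi; have [L1 M1 R1] := plsplit_atE i.
pose S := plsplit_at i; exists (plcomp F (plinv S)).
have GE t : plcomp F (plinv S) t = F (pli S t) by [].
have SL t : t <= i%:~R -> pli S t = t.
  by move=> ti; apply: (pl_inj (F := S)); rewrite pliK [RHS]L1.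
have SM t : i%:~R <= t <= i%:~R + 2 -> pli S t = (t + i%:~R) / 2.
  move=> /andP[t1 t2]; apply: (pl_inj (F := S)); rewrite pliK [RHS]M1; first lra.
  by apply/andP; split; lra.
have SR t : i%:~R + 2 <= t -> pli S t = t - 1.
  by move=> ti; apply: (pl_inj (F := S)); rewrite pliK [RHS]R1; lra.
split => [x|l|]; first exact: (congr1 F (esym (plK S x))).
- have [li|il|->] := ltgtP l i.
  + have [k' [j' Fl]] := EF l; exists k', j' => t tl; rewrite GE SL ?Fl//.
    have : l%:~R + 1 <= i%:~R :> R by rewrite -[1]/(1%:~R) -intrD ler_int -ltzD1 ltrD2r.
    by move: tl => /andP[_ h]; lra.
  + have [lS|Sl] := leP l (i + 1).
      have -> : l = i + 1 by apply/eqP; rewrite eq_le lS/= lezD1.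
      exists k, (j + 2 ^+ k) => t /andP[]; rewrite !intrD => t1 t2.
      rewrite GE SM; last by apply/andP; split; lra.
      rewrite Fi; last by apply/andP; split; lra.
      rewrite rmorphXn/= exprS.
      by field.
    have [k' [j' Fl]] := EF (l - 1); exists k', j' => t /andP[t1 t2].
    have h : i%:~R + 1 + 1 <= l%:~R :> R.
      by rewrite -[1]/(1%:~R) -!intrD ler_int -ltzD1 ltrD2r.
    by rewrite GE SR ?Fl ?intrB; [lra| apply/andP; split; lra|lra].
  + exists k, j => t /andP[t1 t2].
    rewrite GE SM; last by apply/andP; split; lra.
    rewrite Fi; last by apply/andP; split; lra.
    by rewrite exprS; field.
- exists (M + `|i| + 2)%N; rewrite !natrD.
  have Mi : `|i%:~R| = `|i|%:R :> R by rewrite -intr_norm -abszE.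
  have := ler_norm (i%:~R : R); have := ler_norm (- i%:~R : R).
  rewrite normrN Mi => n1 n2; have M0 := ler0n R M; have i0 := ler0n R `|i|.
  split=> t tM; first by rewrite GE SL ?FL//; lra.
  by rewrite GE SR ?FR ?intrB; lra.
Qed.

Lemma ends_comp F G m n m' n' : ends F m n -> ends G m' n' ->
  ends (plcomp F G) (m + m') (n + n').
Proof.
move=> [M [FL FR]] [M' [GL GR]]; exists (M + M' + `|m'| + `|n'|)%N; rewrite !natrD.
have Am : `|m'%:~R| = `|m'|%:R :> R by rewrite -intr_norm -abszE.
have An : `|n'%:~R| = `|n'|%:R :> R by rewrite -intr_norm -abszE.
have := ler_norm (m'%:~R : R); have := ler_norm (- n'%:~R : R); rewrite normrN Am An => n1 n2.
have := ler0n R M'; have := ler0n R M; have := ler0n R `|m'|; have := ler0n R `|n'| => h1 h2 h3 h4.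
split=> t tM; rewrite [LHS]/=; first by rewrite GL ?FL ?intrD; lra.
by rewrite GR ?FR ?intrD; lra.
Qed.

Lemma ends_inv F m n : ends F m n -> ends (plinv F) (- m) (- n).
Proof.
move=> [M [FL FR]]; exists (M + `|m| + `|n|)%N; rewrite !natrD.
have Am : `|m%:~R| = `|m|%:R :> R by rewrite -intr_norm -abszE.
have An : `|n%:~R| = `|n|%:R :> R by rewrite -intr_norm -abszE.
have := ler_norm (n%:~R : R); have := ler_norm (- m%:~R : R); rewrite normrN Am An => n1 n2.
have := ler0n R `|m|; have := ler0n R `|n| => h1 h2.
by split=> t tM; apply: (pl_inj (F := F)); rewrite [LHS]pliK rmorphN/=; [rewrite FL|rewrite FR]; lra.
Qed.

(** Multiplication by 2 ^ N cut off outside [-M, M] so as to lie in F: the outer translations fit at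
    M and -M because M * 2 ^ N - M is an integer. *)
Lemma scaling_ex (N M : nat) : exists (S : pl R) (m n : int), [/\ expanding S,
  forall t, t <= - M%:R -> S t = t + m%:~R, forall t, M%:R <= t -> S t = t + n%:~R &
  forall t, - M%:R <= t <= M%:R -> S t = 2 ^+ N * t].
Proof.
pose j : int := M%:Z * (2 ^+ N - 1).
have jE : j%:~R = M%:R * (2 ^+ N - 1) :> R by rewrite intrM intrB rmorphXn.
have [||S1 [L1 R1]] := @plglue_ex R (plsh (dyad_int (- j))) (plaff (pow2X N) dyad0) (- M%:R).
- by apply: dyadN; exact: dyad_nat.
- by rewrite plshE rmorphN/= jE; lra.
have M0 := ler0n R M.
have [||S2 [L2 R2]] := @plglue_ex R S1 (plsh (dyad_int j)) M%:R.
- exact: dyad_nat.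
- by rewrite R1 ?plshE/= ?jE; lra.
have SL t : t <= - M%:R -> S2 t = t - j%:~R.
  by move=> tM; rewrite L2 ?L1 ?plshE ?rmorphN//; lra.
have SR t : M%:R <= t -> S2 t = t + j%:~R.
  by move=> tM; rewrite R2 ?plshE.
have SM t : - M%:R <= t <= M%:R -> S2 t = 2 ^+ N * t.
  by move=> /andP[t1 t2]; rewrite L2 ?R1//= addr0.
exists S2, (- j), j; split => //; last by move=> t tM; rewrite SL// rmorphN.
move=> i; have [Mi|iM] := leP M%:Z i.
  exists 0%N, (i + j) => t /andP[t1 _]; rewrite SR ?intrD ?expr0; first lra.
  by rewrite (le_trans _ t1)// -[M%:R]/(M%:~R) ler_int.
have [iM'|Mi] := ltP i (- M%:Z).
  exists 0%N, (i - j) => t /andP[_ t1]; rewrite SL ?intrB ?expr0; first lra.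
  by rewrite (le_trans t1)// -[M%:R]/(M%:~R) -rmorphN -[1]/(1%:~R) -intrD ler_int -ltzD1 ltrD2r.
exists N, (2 ^+ N * i) => t /andP[t1 t2]; rewrite SM; first by rewrite intrM rmorphXn/=; ring.
move: Mi iM; rewrite -lezD1 -!(ler_int R) rmorphN/= intrD => Mi iM.
by apply/andP; split; lra.
Qed.

Lemma uniform_bound (Q : nat -> int -> Prop) : (forall i, exists n, forall N, (n <= N)%N -> Q N i) ->
  forall m : nat, exists n, forall N, (n <= N)%N -> forall i : int, (`|i| <= m)%N -> Q N i.
Proof.
move=> hQ; elim=> [|m [n IH]].
  have [n hn] := hQ 0; exists n => N nN i; rewrite leqn0 absz_eq0 => /eqP ->.
  exact: hn.
have [n1 h1] := hQ m.+1; have [n2 h2] := hQ (- m.+1%:Z).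
exists (maxn n (maxn n1 n2)) => N; rewrite !geq_max => /and3P[nN n1N n2N] i.
rewrite leq_eqVlt => /orP[/eqP im|]; last by rewrite ltnS; exact: IH.
have [i0|i0] := leP 0 i; first by rewrite -(gez0_abs i0) im; exact: h1.
by rewrite -[i]opprK -(ltz0_abs i0) im; exact: h2.
Qed.

Section Gen.
(** [C] is an arbitrary predicate, so that generation of F becomes an induction principle:
    [model_ends] applies it to a predicate that carries an element of H together with its
    exponents. *)
Variable C : pl R -> Prop.
Hypothesis Cext : forall F G, C F -> (forall x, F x = G x) -> C G.
Hypothesis Ccomp : forall F G, C F -> C G -> C (plcomp F G).
Hypothesis Cinv : forall F, C F -> C (plinv F).
Hypothesis Csh : C (plsh dyad1).
Hypothesis Csplit : C plsplit.

Lemma gen_int (m : int) : C (plsh (dyad_int m)).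
Proof.
elim/int_ind: m => [|m IH|m IH].
- by apply: Cext (Ccomp (Cinv Csh) Csh) _ => x; rewrite plshE addr0; exact: plK.
- by apply: Cext (Ccomp Csh IH) _ => x /=; rewrite !mul1r -addn1 PoszD intrD addrA.
- apply: Cext (Ccomp (Cinv Csh) IH) _ => x /=.
  by rewrite !mul1r invr1 mul1r -addn1 PoszD opprD intrD addrA.
Qed.

Lemma gen_split i : C (plsplit_at i).
Proof. by apply: Ccomp; [exact: gen_int|apply: Ccomp; [exact: Csplit|exact: gen_int]]. Qed.

(* Induction on [n - m]: [plsplit_at i] performs the first doubling on a cell
   that [F] stretches. *)
Lemma gen_expanding F m n : expanding F -> ends F m n -> C F.
Proof.
move=> EF Fmn; have [r nr] : exists r : nat, n <= m + r%:Z.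
  by exists `|n - m|%N; rewrite -lerBlDl gez0_abs// subr_ge0 (expanding_ends_le EF Fmn).
elim: r F n nr EF Fmn => [|r IH] F n nr EF Fmn.
all: have [[i [k [j Fi]]]|nos] := pselect (exists (i : int) (k : nat) (j : int),
  forall t, i%:~R <= t <= i%:~R + 1 -> F t = 2 ^+ k.+1 * (t - i%:~R) + j%:~R).
2, 4: by apply: Cext (gen_int m) _ => t; rewrite plshE (expanding_shift EF Fmn nos).
all: have [G [FG EG Gmn]] := expanding_reduce EF Fmn Fi.
  have := expanding_ends_le EG Gmn; rewrite lerBrDr => mn.
  by move: nr; rewrite addr0 leNgt (lt_le_trans _ mn)// ltrDl.
apply: Cext (Ccomp (IH G (n - 1) _ EG Gmn) (gen_split i)) _.
  by rewrite lerBlDr -addrA -PoszD addn1.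
by move=> x; rewrite FG.
Qed.

(* Scaling up first the domain and then the range turns [F] into an expanding
   map. *)
Theorem gen_ends F m n : ends F m n -> C F.
Proof.
move=> Fmn; have [M [FL FR]] := Fmn.
have M0 := ler0n R M.
have [|N /(_ N (leqnn _)) hN] := @pl_level F (- M%:R) M%:R; first lra.
have [S [mS [nS [ES SL SR SM]]]] := scaling_ex N M.
have Send : ends S mS nS by exists M.
have N0 := exp2_gt0 N : 0 < 2 ^+ N :> R.
have SMr : S M%:R = 2 ^+ N * M%:R by rewrite SM//; apply/andP; split; lra.
have SMl : S (- M%:R) = 2 ^+ N * - M%:R by rewrite SM//; apply/andP; split; lra.
(* The cells of level N in [-M, M], on which F is affine, become under S the unit cells between - M
   * 2 ^ N and M * 2 ^ N. *)
pose F1 t := F (pli S t).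
have F1E t : - M%:R <= t * (2 ^+ N)^-1 <= M%:R -> F1 t = F (t * (2 ^+ N)^-1).
  move=> /SM h; congr (F _); apply: (pl_inj (F := S)); rewrite pliK h.
  by rewrite mulrC mulfVK ?gt_eqF.
pose inside (i : int) := (- (M * 2 ^ N)%:Z <= i) && (i < (M * 2 ^ N)%:Z).
have insideE i : inside i -> - M%:R * 2 ^+ N <= i%:~R :> R /\ i%:~R + 1 <= M%:R * 2 ^+ N :> R.
  by move=> /andP[]; rewrite -lezD1 -!(ler_int R) rmorphN/= -[(_ * _)%:Z%:~R]/((M * 2 ^ N)%:R) natrM natrX intrD mulNr.
have F1in i : exists a c, [/\ pow2 a, dyad c & inside i ->
    forall t, i%:~R <= t <= i%:~R + 1 -> F1 t = a * t + c].
  have [ii|] := boolP (inside i); last by exists 1, 0; split => //; [exact: pow21|exact: dyad0].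
  have [i1 i2] := insideE i ii.
  have [a [c [pa dc hac]]] := hN i i1 i2.
  exists (a * (2 ^+ N)^-1), c; split => //; first exact/pow2M/pow2V/pow2X.
  move=> _ t /andP[t1 t2]; rewrite F1E ?hac; first by rewrite mulrA mulrAC.
    by rewrite mulfVK ?gt_eqF// t1.
  by rewrite ler_pdivlMr// ler_pdivrMr//; apply/andP; split; lra.
have F1out i : ~~ inside i -> exists j : int, forall t, i%:~R <= t <= i%:~R + 1 -> F1 t = t + j%:~R.
  rewrite negb_and -ltNge -leNgt => /orP[iM|Mi]; [exists (m - mS)|exists (n - nS)] => t /andP[t1 t2].
    have tM : t <= 2 ^+ N * - M%:R.
      apply: (le_trans t2); move: iM; rewrite -lezD1 -(ler_int R) intrD rmorphN/=.
      by rewrite -[(_ * _)%:Z%:~R]/((M * 2 ^ N)%:R) natrM natrX; lra.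
    have := SL (- M%:R) (lexx _); rewrite SMl => SME.
    rewrite /F1 (_ : pli S t = t - mS%:~R) ?FL ?intrB; [lra|lra|].
    by apply: (pl_inj (F := S)); rewrite pliK SL; lra.
  have tM : 2 ^+ N * M%:R <= t.
    apply: (le_trans _ t1); move: Mi; rewrite -(ler_int R).
    by rewrite -[(_ * _)%:Z%:~R]/((M * 2 ^ N)%:R) natrM natrX; lra.
  have := SR M%:R (lexx _); rewrite SMr => SME.
  rewrite /F1 (_ : pli S t = t - nS%:~R) ?FR ?intrB; [lra|lra|].
  by apply: (pl_inj (F := S)); rewrite pliK SR; lra.
(* A large power of two clears all denominators: it turns the gradients on the inner unit cells into
   [2 ^+ k] with k natural, and the values at their endpoints into integers. *)
have [N' hN'] : exists N', forall i, inside i -> exists (k : nat) (j : int),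
    forall t, i%:~R <= t <= i%:~R + 1 -> 2 ^+ N' * F1 t = 2 ^+ k * (t - i%:~R) + j%:~R.
  have [i|N' /(_ N' (leqnn _)) hN'] := @uniform_bound (fun N' i => inside i -> exists (k : nat) (j : int),
    forall t, i%:~R <= t <= i%:~R + 1 -> 2 ^+ N' * F1 t = 2 ^+ k * (t - i%:~R) + j%:~R) _ (M * 2 ^ N)%N; last first.
    exists N' => i ii; apply: hN' => //; have /andP[i1 i2] := ii.
    by rewrite -lez_nat abszE ler_norml i1 ltW.
  have [a [c [[k ak] dc Fi]]] := F1in i.
  have [l hl] := dyad_exp2 (dyadD (dyadM (pow2_dyad (ex_intro _ k ak)) (dyad_int i)) dc).
  exists (maxn `|k| l) => N'; rewrite geq_max => /andP[kN lN] ii.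
  have [j hj] := hl _ lN; exists `|(N'%:Z + k)%R|%N, j => t ti.
  have kE : 2 ^+ `|(N'%:Z + k)%R|%N = 2 ^+ N' * a :> R.
    rewrite exprnP gez0_abs; first by rewrite expfzDr ?pnatr_eq0// -ak.
    by rewrite -lerBlDr sub0r (le_trans (ler_norm _))// normrN -abszE.
  by rewrite Fi// -hj kE; ring.
(* F maps [-M, M] onto [-M + m, M + n]; this lies in [-M', M'], where [S'] is multiplication by 2 ^
   N'. *)
pose M' := (M + `|m| + `|n|)%N.
have [S' [mS' [nS' [ES' SL' SR' SM']]]] := scaling_ex N' M'.
have Send' : ends S' mS' nS' by exists M'.
have EG : expanding (plcomp S' (plcomp F (plinv S))).
  move=> i; have [ii|ni] := boolP (inside i).
    have [k [j kj]] := hN' i ii; exists k, j => t ti; rewrite -kj//; apply: SM'.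
    have [i1 i2] := insideE i ii; move: ti => /andP[t1 t2].
    have Am : `|m%:~R| = `|m|%:R :> R by rewrite -intr_norm -abszE.
    have An : `|n%:~R| = `|n|%:R :> R by rewrite -intr_norm -abszE.
    have := ler_norm (n%:~R : R); have := ler_norm (- m%:~R : R); rewrite normrN Am An => n1 n2.
    have FLM : F (- M%:R) <= F1 t.
      by rewrite pl_mono -(pl_mono S) pliK SMl; lra.
    have FRM : F1 t <= F M%:R.
      by rewrite pl_mono -(pl_mono S) pliK SMr; lra.
    rewrite FL// in FLM; rewrite FR// in FRM.
    have -> : plcomp F (plinv S) t = F1 t by [].
    rewrite /M' !natrD.
    by have := ler0n R `|m|; have := ler0n R `|n| => h1 h2; apply/andP; split; lra.
  have [j Fj] := F1out i ni; have [k [l kl]] := ES' (i + j).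
  exists k, l => t /[dup] ti /andP[t1 t2].
  have -> : plcomp S' (plcomp F (plinv S)) t = S' (t + j%:~R) by rewrite -Fj.
  by rewrite kl intrD; [ring|apply/andP; split; lra].
have CS := gen_expanding ES Send; have CS' := gen_expanding ES' Send'.
have CG := gen_expanding EG (ends_comp Send' (ends_comp Fmn (ends_inv Send))).
apply: Cext (Ccomp (Cinv CS') (Ccomp CG CS)) _ => x.
exact: etrans (plK S' _) (congr1 F (plK S x)).
Qed.

End Gen.

End Generation.

(** * Two conjugate overlapping bumps generating F on an interval *)

Section Model.
Context {R : realType}.
Implicit Types (a b c d e x y t : R) (F G : pl R).

(* [lam] maps the line onto ]0, 1[ in such a way that a map which is a
   translation near -oo and +oo becomes affine near 0 and near 1. *)
Definition lam t : R :=
  let f s := let n := Num.truncn s in 1 - (2 - (s - n%:R)) / 2 ^+ n.+2 in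
  if 0 <= t then f t else 1 - f (- t).

(** The cell [n, n + 1] goes onto [1 - 2 ^ -(n + 1), 1 - 2 ^ -(n + 2)]. It is closed at both ends
    because the formulas of neighbouring cells agree at the common integer. *)
Lemma lamE (n : nat) t : n%:R <= t <= n%:R + 1 -> lam t = 1 - (2 - (t - n%:R)) / 2 ^+ n.+2.
Proof.
move=> /andP[nt tn]; have t0 : 0 <= t by rewrite (le_trans _ nt).
rewrite /lam t0; have [tn'|nt'] := lt_or_le t (n%:R + 1).
  by rewrite (@truncn_def _ t n)// nt -natr1.
have -> : t = n.+1%:R by rewrite -natr1; light_lra.
rewrite natrK -(natr1 n) (exprS _ n.+2); field.
exact: exp2_neq0.
Qed.

Lemma lam0 : lam 0 = 2^-1.
Proof. by rewrite (@lamE 0) ?lexx ?add0r ?ler01//; field. Qed.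

Lemma lamN t : lam (- t) = 1 - lam t.
Proof.
have [t0|t0|<-] := ltgtP 0 t; last by rewrite oppr0 lam0; light_lra.
  by rewrite {1}/lam oppr_ge0 leNgt t0/= opprK /lam (ltW t0).
by rewrite [in RHS]/lam leNgt t0/= [in LHS]/lam oppr_ge0 (ltW t0) subKr.
Qed.

Lemma lamNE (n : nat) t : - (n%:R + 1) <= t <= - n%:R -> lam t = (2 - (- t - n%:R)) / 2 ^+ n.+2.
Proof.
move=> /andP[t1 t2]; rewrite -[t in LHS]opprK lamN (@lamE n); first light_lra.
by apply/andP; split; light_lra.
Qed.

Lemma nat_cell t : 0 <= t -> exists n : nat, n%:R <= t <= n%:R + 1.
Proof.
move=> t0; exists (Num.truncn t).
by have /andP[-> h] := truncn_itv t0; rewrite natr1 ltW.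
Qed.

Lemma natN_cell t : t <= 0 -> exists n : nat, - (n%:R + 1) <= t <= - n%:R.
Proof.
rewrite -oppr_ge0 => /nat_cell[n /andP[n1 n2]]; exists n.
by apply/andP; split; light_lra.
Qed.

(** With the next two lemmas: seen through [lam], the unit translation is 2 y up to 1/4, y + 1/4 up
    to 1/2 and (1 + y) / 2 beyond, which up to inversion is the standard generator x_0 of F on
    [0, 1]. *)
Lemma lam_shiftR t : 0 <= t -> lam (t + 1) = (1 + lam t) / 2.
Proof.
move=> /nat_cell[n nt]; rewrite (lamE nt) (@lamE n.+1) -(natr1 n); last first.
  by move: nt => /andP[t1 t2]; apply/andP; split; light_lra.
by rewrite (exprS _ n.+2); field; exact: exp2_neq0.
Qed.

Lemma lam_shiftL t : t <= -1 -> lam (t + 1) = 2 * lam t.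
Proof.
move=> t1; have := @lam_shiftR (- (t + 1)).
by rewrite (_ : - (t + 1) + 1 = - t) ?lamN; [move=> h; have := h ltac:(light_lra); light_lra|light_lra].
Qed.

Lemma lam_shiftM t : -1 <= t <= 0 -> lam t = 2^-1 + t / 4 /\ lam (t + 1) = 3 / 4 + t / 4.
Proof.
move=> /andP[t1 t2]; rewrite (@lamNE 0) ?(@lamE 0); last 2 first.
- by apply/andP; split; light_lra.
- by apply/andP; split; light_lra.
by split; field.
Qed.

(** [lam] is not onto the line, hence not in [pl]; agreeing with a member of [pl] on each bounded
    interval is enough for monotonicity, for surjectivity onto ]0, 1[ and for transporting maps. *)
Lemma lam_approx (M : nat) : exists G : pl R, forall t, - M%:R <= t <= M%:R -> G t = lam t.
Proof.
elim: M => [|M [G HG]].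
  exists (plaff (pow2V (pow2X 1)) (@dyad_half R)) => t.
  by rewrite oppr0 -eq_le => /eqP <-; rewrite lam0 /= mulr0 add0r.
have M0 := ler0n R M; have dM : dyad (M%:R : R) := dyad_nat M.
have p := pow2V (@pow2X R M.+2).
have dp := pow2_dyad p.
have d2 : dyad (2 : R) := dyad_nat 2.
have d3 : dyad ((2 + M%:R) * (2 ^+ M.+2)^-1 : R) by apply: dyadM dp; exact: dyadD.
have d4 : dyad (1 - (2 + M%:R) * (2 ^+ M.+2)^-1 : R) by apply: dyadB => //; exact: dyad1.
have [|G1 [L1 R1]] := @plglue_ex R G (plaff p d4) M%:R dM.
  by rewrite HG ?(@lamE M)/=; [field; exact: exp2_neq0|apply/andP; split; light_lra|apply/andP; split; light_lra].
have [|G2 [L2 R2]] := @plglue_ex R (plaff p d3) G1 (- M%:R) (dyadN dM).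
  by rewrite L1 ?HG ?(@lamNE M)/=; [field; exact: exp2_neq0|apply/andP; split; light_lra|apply/andP; split; light_lra|light_lra].
exists G2 => t; rewrite -natr1 => /andP[t1 t2].
have [tM|tM] := le_or_lt t (- M%:R).
  by rewrite L2// (@lamNE M) /=; [field; exact: exp2_neq0|apply/andP; split; light_lra].
rewrite R2 ?ltW//; have [Mt|Mt] := le_or_lt t M%:R.
  by rewrite L1// HG// ltW.
by rewrite R1 ?ltW// (@lamE M)/=; [field; exact: exp2_neq0|apply/andP; split; light_lra].
Qed.

Lemma nat_bound x : exists M : nat, - M%:R <= x <= M%:R.
Proof.
exists (Num.truncn `|x|).+1; rewrite -ler_norml ltW// truncnS_gt//.
Qed.

Lemma lam_mono : {mono lam : x y / x <= y}.
Proof.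
apply: mono_of_incr => x y xy.
have [M1 /andP[h1 h2]] := nat_bound x; have [M2 /andP[h3 h4]] := nat_bound y.
have [G HG] := lam_approx (M1 + M2).
have := ler0n R M1; have := ler0n R M2 => h5 h6.
by rewrite -!HG ?plS// natrD; apply/andP; split; light_lra.
Qed.

Lemma lam_gt0 t : 0 < lam t.
Proof.
have : lam (- `|t|) <= lam t by rewrite lam_mono lerNl -normrN ler_norm.
apply: lt_le_trans.
have /natN_cell[n ni] : - `|t| <= 0 by rewrite oppr_le0.
rewrite (lamNE ni) divr_gt0 ?exp2_gt0//; light_lra.
Qed.

Lemma lam_lt1 t : lam t < 1.
Proof. by have := lam_gt0 (- t); rewrite lamN; light_lra. Qed.

Lemma lam_near0 e : 0 < e -> exists N : nat, forall M, (N <= M)%N -> lam (- M%:R) < e.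
Proof.
move=> /exp2_small[N Ne]; exists N => M NM.
rewrite (@lamNE M); last by apply/andP; split; light_lra.
apply: le_lt_trans Ne; rewrite (_ : _ / _ = (2 ^+ M.+1)^-1); last first.
  by rewrite (exprS _ M.+1); field; exact: exp2_neq0.
rewrite lef_pV2 ?posrE ?exp2_gt0//; apply: exp2_le; exact: leqW.
Qed.

Lemma lam_near1 e : 0 < e -> exists N : nat, forall M, (N <= M)%N -> 1 - e < lam M%:R.
Proof.
move=> /lam_near0[N hN]; exists N => M /hN; rewrite lamN; light_lra.
Qed.

Lemma lam_onto y : 0 < y < 1 -> exists t, lam t = y.
Proof.
move=> /andP[y0 y1].
have [N1 h1] := lam_near0 y0.
have [|N2 h2] := @lam_near1 (1 - y); first light_lra.
have {}h1 := h1 (N1 + N2)%N (leq_addr _ _).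
have {}h2 := h2 (N1 + N2)%N (leq_addl _ _).
have [G HG] := lam_approx (N1 + N2).
have N0 := ler0n R (N1 + N2).
exists (pli G y); rewrite -HG ?pliK//.
have Gl : G (- (N1 + N2)%:R) = lam (- (N1 + N2)%:R) by rewrite HG//; apply/andP; split; light_lra.
have Gr : G (N1 + N2)%:R = lam (N1 + N2)%:R by rewrite HG//; apply/andP; split; light_lra.
by apply/andP; split; rewrite -(pl_mono G) pliK ?Gl ?Gr; light_lra.
Qed.

(** Up to inversion this is the standard generator x_1 of F: the map x_0 shrunk to the interval
    [1/2, 1]. *)
Lemma plbump_ex : exists V : pl R, [/\ forall y, y <= 2^-1 -> V y = y,
  forall y, 2^-1 <= y <= 5 / 8 -> V y = 2 * y - 2^-1,
  forall y, 5 / 8 <= y <= 3 / 4 -> V y = y + 8^-1,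
  forall y, 3 / 4 <= y <= 1 -> V y = (1 + y) / 2
 & forall y, 1 <= y -> V y = y].
Proof.
have dh := @dyad_half R.
have d8 : dyad (8^-1 : R) by exists 1, 3%N; field.
have d58 : dyad (5 / 8 : R) by exists 5, 3%N; field.
have d34 : dyad (3 / 4 : R) by exists 3, 2%N; field.
have [|V1 [L1 R1]] := @plglue_ex R plid (plaff pow22 (dyadN dh)) 2^-1 dh.
  by rewrite plidE/=; light_lra.
have [|V2 [L2 R2]] := @plglue_ex R V1 (plsh d8) (5 / 8) d58.
  by rewrite R1/= ?mul1r; light_lra.
have [|V3 [L3 R3]] := @plglue_ex R V2 (plaff pow2h dh) (3 / 4) d34.
  by rewrite R2/= ?mul1r; light_lra.
have [|V4 [L4 R4]] := @plglue_ex R V3 plid 1 dyad1.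
  by rewrite R3 ?plidE/=; light_lra.
exists V4; split => y.
- by move=> y1; rewrite L4 ?L3 ?L2 ?L1 ?plidE; light_lra.
- by move=> /andP[y1 y2]; rewrite L4 ?L3 ?L2 ?R1/=; light_lra.
- by move=> /andP[y1 y2]; rewrite L4 ?L3 ?R2/=; light_lra.
- by move=> /andP[y1 y2]; rewrite L4 ?R3/=; light_lra.
- by move=> y1; rewrite R4 ?plidE.
Qed.

Definition bump : pl R := projT1 (cid plbump_ex).

Lemma bumpE : [/\ forall y, y <= 2^-1 -> bump y = y,
  forall y, 2^-1 <= y <= 5 / 8 -> bump y = 2 * y - 2^-1,
  forall y, 5 / 8 <= y <= 3 / 4 -> bump y = y + 8^-1,
  forall y, 3 / 4 <= y <= 1 -> bump y = (1 + y) / 2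
 & forall y, 1 <= y -> bump y = y].
Proof. by rewrite /bump; case: cid. Qed.

(** The unit translation composed with the inverse of [bump] has support [0, 7/8] in the [lam]
    picture. This map carries [1/2, 1] there and conjugates [bump] into that composite; [lam_shift]
    is the verification. *)
Lemma pltau_ex : exists T : pl R, (forall y, y <= 7 / 8 -> T y = 2 * y - 1) /\
  (forall y, 7 / 8 <= y -> T y = y - 8^-1).
Proof.
have d8 : dyad (8^-1 : R) by exists 1, 3%N; field.
have d78 : dyad (7 / 8 : R) by exists 7, 3%N; field.
have [|V1 [L1 R1]] := @plglue_ex R (plaff pow22 (dyadN dyad1)) (plsh (dyadN d8)) (7 / 8) d78.
  by rewrite plshE/=; light_lra.
by exists V1; split => y yy; [rewrite L1|rewrite R1//= mul1r].
Qed.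

Definition tau : pl R := projT1 (cid pltau_ex).

Lemma tauE : (forall y, y <= 7 / 8 -> tau y = 2 * y - 1) /\
  (forall y, 7 / 8 <= y -> tau y = y - 8^-1).
Proof. by rewrite /tau; case: cid. Qed.

(* [bump] is [plsplit] seen through [lam], and [bump_conj \o bump] is the unit
   translation: so these two conjugate maps, with supports [1/2, 1] and
   [0, 7/8], generate F. *)
Definition bump_conj : pl R := plcomp tau (plcomp bump (plinv tau)).

Lemma bump_conj_tau z : bump_conj (tau z) = tau (bump z).
Proof. by rewrite /= plK. Qed.

Lemma lam_split t : lam (plsplit t) = bump (lam t).
Proof.
have [b1 b2 b3 b4 b5] := bumpE; have [s1 s2 s3] := @plsplitE R.
have l0 := lam0; have [_ l1] := @lam_shiftM 0 ltac:(apply/andP; split; light_lra).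
rewrite add0r in l1.
have [t0|t0] := le_or_lt t 0.
  by rewrite s1// b1// -lam0 lam_mono.
have [t1|t1] := le_or_lt 1 t.
  rewrite s3// b4 ?lam_shiftR//; first light_lra.
  by rewrite (ltW (lam_lt1 _)) andbT (_ : 3 / 4 = lam 1) ?lam_mono// l1; light_lra.
rewrite s2; last by apply/andP; split; light_lra.
have lt : lam t = 2^-1 + t / 4 by rewrite (@lamE 0); [field|apply/andP; split; light_lra].
rewrite lt; have [th|th] := le_or_lt t 2^-1.
  rewrite b2 ?(@lamE 0); first by field.
    by apply/andP; split; light_lra.
  by apply/andP; split; light_lra.
rewrite b3 ?(@lamE 1); first by field.
  by apply/andP; split; light_lra.
by apply/andP; split; light_lra.
Qed.

Lemma lam_shift t : bump_conj (bump (lam t)) = lam (t + 1).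
Proof.
have [b1 b2 b3 b4 b5] := bumpE; have [T1 T2] := tauE.
have l0 := lam0; have [_ l1] := @lam_shiftM 0 ltac:(apply/andP; split; light_lra).
have [lm1 _] := @lam_shiftM (-1) ltac:(apply/andP; split; light_lra).
rewrite add0r in l1.
(* On each piece [bump_conj] is evaluated at an explicit preimage under [tau], so that no inverse
   has to be computed. *)
have B' y z : tau z = y -> bump_conj y = tau (bump z) by move=> <-; exact: bump_conj_tau.
have [t0|t0] := le_or_lt t 0.
  have ly : lam t <= 2^-1 by rewrite -lam0 lam_mono.
  have ly0 := lam_gt0 t.
  rewrite b1// (@B' _ ((lam t + 1) / 2)); last by rewrite T1; light_lra.
  have [t1|t1] := le_or_lt t (-1).
    have ly1 : lam t <= 4^-1 by apply: (@le_trans _ _ (lam (-1))); [rewrite lam_mono|rewrite lm1; light_lra].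
    rewrite lam_shiftL// b2 ?T1; light_lra.
  have [lt lt1] := @lam_shiftM t ltac:(apply/andP; split; light_lra).
  rewrite lt1 lt b3 ?T1; light_lra.
have [t1|t1] := le_or_lt 1 t.
  have h : lam t < 1 by exact: lam_lt1.
  have h' : 3 / 4 <= lam t by rewrite (_ : 3 / 4 = lam 1) ?lam_mono// l1; light_lra.
  rewrite b4; last by apply/andP; split; light_lra.
  rewrite (@B' _ ((1 + lam t) / 2 + 8^-1)); last by rewrite T2; light_lra.
  rewrite b5 ?T2 ?lam_shiftR; light_lra.
have lt : lam t = 2^-1 + t / 4 by rewrite (@lamE 0); [field|apply/andP; split; light_lra].
have lt1 : lam (t + 1) = 3 / 4 + t / 8 by rewrite (@lamE 1); [field|apply/andP; split; light_lra].
rewrite lt lt1; have [th|th] := le_or_lt t 2^-1.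
  rewrite b2; last by apply/andP; split; light_lra.
  rewrite (@B' _ (3 / 4 + t / 4)); last by rewrite T1; light_lra.
  rewrite b4 ?T2; light_lra.
rewrite b3; last by apply/andP; split; light_lra.
rewrite (@B' _ (3 / 4 + t / 4)); last by rewrite T2; light_lra.
rewrite b4 ?T2; light_lra.
Qed.

Lemma bump_id y : y <= 2^-1 \/ 1 <= y -> bump y = y.
Proof. by have [b1 _ _ _ b5] := bumpE; case; auto. Qed.

Lemma tau_half : tau 2^-1 = 0. Proof. by rewrite tauE.1; light_lra. Qed.
Lemma tau_1 : tau 1 = 7 / 8. Proof. by rewrite tauE.2; light_lra. Qed.

Lemma bump_conj_id y : y <= 0 \/ 7 / 8 <= y -> bump_conj y = y.
Proof.
rewrite -[y](pliK tau) bump_conj_tau -{1}tau_half -tau_1 !pl_mono => h.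
by rewrite bump_id.
Qed.

End Model.

(** * From a generating pair on an arc to all maps supported in it *)

Section Fin.
Context {R : realType}.
Implicit Types (a b c d e x y t : R) (F G f g h : pl R) (m n : int).

Definition periodic F := forall x, F (x + 1) = F x + 1.

Lemma periodic_int F : periodic F -> forall x m, F (x + m%:~R) = F x + m%:~R.
Proof.
move=> pF x; elim/int_ind=> [|n IH|n IH]; first by rewrite !addr0.
  by rewrite -addn1 PoszD intrD !addrA pF IH.
apply: (@addIr _ 1); rewrite -pF -addn1 PoszD opprD intrD !addrA.
by rewrite -[_ + _ + 1]addrA addNr addr0 IH -[RHS]addrA addNr addr0.
Qed.

Lemma periodicB F : periodic F -> forall x, F (x - 1) = F x - 1.
Proof. by move=> pF x; exact: (periodic_int pF x (-1)). Qed.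

Lemma periodic_inv F : periodic F -> periodic (plinv F).
Proof. by move=> pF x; apply: (pl_inj (F := F)); rewrite pF !pliK. Qed.

Lemma periodic_comp F G : periodic F -> periodic G -> periodic (plcomp F G).
Proof. by move=> pF pG x /=; rewrite pG pF. Qed.

Lemma int_translate x a : exists m, a < x + m%:~R <= a + 1.
Proof.
exists (Num.floor (a - x) + 1).
have /andP[] := floor_itv (a - x); rewrite !intrD; lra.
Qed.

Lemma periodic_ext F G a : periodic F -> periodic G ->
  (forall x, a < x <= a + 1 -> F x = G x) -> forall x, F x = G x.
Proof.
move=> pF pG FG x; have [m mx] := int_translate x a.
by apply: (@addIr _ m%:~R); rewrite -!periodic_int// FG.
Qed.

Definition zpow f m x := match m with Posz n => iter n f x | Negz n => iter n.+1 (pli f) x end.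

Lemma zpowS f m x : zpow f (m + 1) x = f (zpow f m x).
Proof.
case: m => [n|[|n]]; first by rewrite -PoszD addn1.
  by rewrite /= pliK.
have -> : Negz n.+1 + 1 = Negz n by rewrite !NegzE -[n.+2]addn1 PoszD opprD subrK.
by rewrite [RHS]/= pliK.
Qed.

Lemma zpowB f m x : zpow f (m - 1) x = pli f (zpow f m x).
Proof. by rewrite -[m in RHS](subrK 1) zpowS plK. Qed.

Lemma zpowD f m n x : zpow f (m + n) x = zpow f m (zpow f n x).
Proof.
elim/int_ind: m => [|m IH|m IH]; first by rewrite add0r.
  by rewrite -addn1 PoszD addrAC !zpowS IH.
by rewrite -addn1 PoszD opprD addrAC !zpowB IH.
Qed.

(* [f] and [g] have disjoint supports in [b, c], so the [g]-orbit of a fixed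
   point of [f] consists of fixed points of [f]. *)
Lemma zpow_fix f g b c : g b = b -> g c = c ->
  (forall x, b <= x <= c -> f x = x \/ g x = x) ->
  forall x m, b <= x <= c -> f x = x ->
  b <= zpow g m x <= c /\ f (zpow g m x) = zpow g m x.
Proof.
move=> gb gc fg x m xbc fx.
have step y : b <= y <= c -> f y = y -> b <= g y <= c /\ f (g y) = g y.
  move=> ybc fy; have gy : b <= g y <= c by rewrite -gb -gc !pl_mono.
  by split => //; case: (fg _ gy) => // /(pl_inj (F := g)) ->.
have stepV y : b <= y <= c -> f y = y -> b <= pli g y <= c /\ f (pli g y) = pli g y.
  move=> ybc fy; have gy : b <= pli g y <= c by rewrite -(pl_mono g) -[pli g y <= c](pl_mono g) pliK gb gc.
  split => //; case: (fg _ gy) => //; by rewrite pliK => <-.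
elim/int_ind: m => [//|m [IH1 IH2]|m [IH1 IH2]].
  by rewrite -addn1 PoszD zpowS; exact: step.
by rewrite -addn1 PoszD opprD zpowB; exact: stepV.
Qed.

(** A group of lifts that contains the unit translation is the full preimage of its image in T.
    Membership has to respect pointwise equality, since distinct records may have the same
    values. *)
Record plgroup (H : pl R -> Prop) : Prop := PLGroup {
  plg_ext : forall F G, H F -> (forall x, F x = G x) -> H G;
  plg_comp : forall F G, H F -> H G -> H (plcomp F G);
  plg_inv : forall F, H F -> H (plinv F);
  plg_sh : H (plsh dyad1);
  plg_per : forall F, H F -> periodic F }.

(* Such an [F] is supported in the integer translates of [a', b']. *)
Definition good (H : pl R -> Prop) a b := forall F, periodic F -> forall a' b',
  a < a' -> b' < b -> (forall x, b' <= x <= a' + 1 -> F x = x) -> H F.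

Lemma ends_uniq F m n m' n' : ends F m n -> ends F m' n' -> m = m' /\ n = n'.
Proof.
move=> [M [FL FR]] [M' [FL' FR']].
have M0 := ler0n R M; have M0' := ler0n R M'.
split; apply/eqP; rewrite -(eqr_int R); apply/eqP.
  by apply: (@addrI _ (- (M + M')%:R)); rewrite natrD -FL -?FL'; lra.
by apply: (@addrI _ (M + M')%:R); rewrite natrD -FR -?FR'; lra.
Qed.

Section Model.
(** [kappa] is a chart from [0, 1] to the arc K in which the pair acts as [bump] and [bump_conj];
    [gO] is the disjointness of the supports on the rest of one period. *)
Variables (H : pl R -> Prop) (g1 g2 kappa : pl R).
Hypotheses (gH : plgroup H) (Hg1 : H g1) (Hg2 : H g2).
Local Notation a := (kappa 0).
Local Notation b := (kappa 1).
Hypotheses (ba : b <= a + 1)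
  (g1E : forall y, 0 <= y <= 1 -> g1 (kappa y) = kappa (bump y))
  (g2E : forall y, 0 <= y <= 1 -> g2 (kappa y) = kappa (bump_conj y))
  (gO : forall x, b <= x <= a + 1 -> g1 x = x \/ g2 x = x).

(* The exponents by which [h] acts outside the arc are read off from [F] near
   -oo and +oo, so they vanish when [F] is compactly supported. *)
Let model F := exists h m n, [/\ H h /\ ends F m n,
  (forall t, h (kappa (lam t)) = kappa (lam (F t))),
  (forall x, b <= x <= a + 1 -> g1 x = x -> h x = zpow g2 m x) &
  (forall x, b <= x <= a + 1 -> g2 x = x -> h x = zpow g1 n x)].

Let g1b : g1 b = b. Proof. by rewrite g1E ?bump_id//; lra. Qed.
Let g2b : g2 b = b. Proof. by rewrite g2E ?bump_conj_id//; lra. Qed.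
Let g1a : g1 (a + 1) = a + 1.
Proof. by rewrite (plg_per gH Hg1) g1E ?bump_id//; lra. Qed.
Let g2a : g2 (a + 1) = a + 1.
Proof. by rewrite (plg_per gH Hg2) g2E ?bump_conj_id//; lra. Qed.

Let gO' x : b <= x <= a + 1 -> g2 x = x \/ g1 x = x.
Proof. by move=> /gO[]; auto. Qed.

Let fix2 := zpow_fix g2b g2a gO.
Let fix1 := zpow_fix g1b g1a gO'.

(** Generation of F as an induction principle: [plsplit], with ends 0 and 1, is realised by [g1],
    and the unit translation, with ends 1 and 1, by [g1] followed by [g2]. So m counts occurrences
    of [g2] and n those of [g1]. *)
Let model_ends F m n : ends F m n -> model F.
Proof.
have lam01 t : 0 <= lam t <= 1 by rewrite !ltW ?lam_gt0 ?lam_lt1.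
apply: gen_ends => {F m n}.
- move=> F G [h [m [n [[Hh Fe] h1 h2 h3]]]] FG; exists h, m, n; split => //.
    by split => //; case: Fe => M [FL FR]; exists M; split => t tM; rewrite -FG; [exact: FL|exact: FR].
  by move=> t; rewrite h1 FG.
- move=> F G [h [m [n [[Hh Fe] h1 h2 h3]]]] [k [m' [n' [[Hk Ge] k1 k2 k3]]]].
  exists (plcomp h k), (m + m'), (n + n'); split => [|t|x xO gx|x xO gx] /=.
  + by split; [exact: plg_comp|exact: ends_comp].
  + by rewrite k1 h1.
  + have [yO gy] := fix2 m' xO gx.
    by rewrite k2// h2// zpowD.
  + have [yO gy] := fix1 n' xO gx.
    by rewrite k3// h3// zpowD.
- move=> F [h [m [n [[Hh Fe] h1 h2 h3]]]].
  exists (plinv h), (- m), (- n); split => [|t|x xO gx|x xO gx].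
  + by split; [exact: plg_inv|exact: ends_inv].
  + by apply: (pl_inj (F := h)); rewrite [LHS]pliK h1 /= pliK.
  + have [yO gy] := fix2 (- m) xO gx.
    by apply: (pl_inj (F := h)); rewrite [LHS]pliK h2// -zpowD subrr.
  + have [yO gy] := fix1 (- n) xO gx.
    by apply: (pl_inj (F := h)); rewrite [LHS]pliK h3// -zpowD subrr.
- exists (plcomp g2 g1), 1, 1; split => [|t|x xO gx|x xO gx].
  + split; first exact: plg_comp.
    by exists 0%N; split => t _; rewrite plshE.
  + by rewrite /plcomp [LHS]/= g1E// -lam_split g2E// lam_split lam_shift plshE.
  + by rewrite /= gx.
  + by have [_ /= ->] := fix1 1 xO gx.
- have [s1 s2 s3] := @plsplitE R.
  exists g1, 0, 1; split => [|t|x xO gx|x xO gx] //.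
  + split => //; exists 1%N; split => t tt; last exact: s3.
    by rewrite s1 ?addr0//; lra.
  + by rewrite g1E// lam_split.
Qed.

(** Read through [kappa] and [lam], F becomes a map Q of the line with ends 0 and 0. The element h
    that models Q agrees with F on K and is the identity on the rest of the period. *)
Theorem model_good : good H a b.
Proof.
move=> F pF a' b' aa bb Fid; have ba' := ba.
have lam01 t : 0 < lam t < 1 by rewrite lam_gt0 lam_lt1.
have [M [Ma Mb]] : exists M : nat, kappa (lam (- M%:R)) < a' /\ b' < kappa (lam M%:R).
  have e1 : 0 < pli kappa a' by rewrite -(plS kappa) pliK.
  have e2 : 0 < 1 - pli kappa b' by rewrite subr_gt0 -(plS kappa) pliK.
  have [N1 h1] := lam_near0 e1; have [N2 h2] := lam_near1 e2.
  have {}h1 := h1 _ (leq_addr N2 N1); have {}h2 := h2 _ (leq_addl N1 N2).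
  by exists (N1 + N2)%N; rewrite -(plS kappa) pliK in h1; rewrite subKr -(plS kappa) pliK in h2.
have M0 := ler0n R M.
have klam t : a < kappa (lam t) < b by rewrite !plS.
have FL t : t <= - M%:R -> F (kappa (lam t)) = kappa (lam t).
  move=> tM; have h : kappa (lam t) <= kappa (lam (- M%:R)) by rewrite pl_mono lam_mono.
  have /andP[k1 k2] := klam t.
  by apply: (@addIr _ 1); rewrite -pF Fid//; apply/andP; split; lra.
have FR t : M%:R <= t -> F (kappa (lam t)) = kappa (lam t).
  move=> tM; have h : kappa (lam M%:R) <= kappa (lam t) by rewrite pl_mono lam_mono.
  have /andP[k1 k2] := klam t.
  by rewrite Fid//; apply/andP; split; lra.
have [G HG] := @lam_approx R M.
(* Conjugation within [pl] needs the approximation G in place of [lam]. It is faithful on [-M, M]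
   only, hence the cut-off to the identity outside. *)
pose P : pl R := plcomp (plinv (plcomp kappa G)) (plcomp F (plcomp kappa G)).
have PE t : kappa (G (P t)) = F (kappa (G t)) by exact: (pliK (plcomp kappa G)).
have PM : P M%:R = M%:R.
  apply: (pl_inj (F := G)); apply: (pl_inj (F := kappa)); rewrite PE.
  by rewrite HG ?FR//; lra.
have PN : P (- M%:R) = - M%:R.
  apply: (pl_inj (F := G)); apply: (pl_inj (F := kappa)); rewrite PE.
  by rewrite HG ?FL//; lra.
have [|Q1 [L1 R1]] := @plglue_ex R plid P _ (dyadN (dyad_nat M)); first by rewrite plidE PN.
have [|Q [L2 R2]] := @plglue_ex R Q1 plid _ (dyad_nat M); first by rewrite R1 ?PM ?plidE//; lra.
have Qe : ends Q 0 0.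
  by exists M; split => t tM; rewrite addr0; [rewrite L2 ?L1 ?plidE//; lra|rewrite R2 ?plidE].
have QE t : kappa (lam (Q t)) = F (kappa (lam t)).
  have [tM|tM] := le_or_lt t (- M%:R); first by rewrite FL// L2 ?L1 ?plidE//; lra.
  have [Mt|Mt] := le_or_lt M%:R t; first by rewrite FR// R2 ?plidE.
  have PP : - M%:R <= P t <= M%:R by apply/andP; split; [rewrite -PN|rewrite -[leRHS]PM]; rewrite pl_mono ltW.
  by rewrite L2 ?R1 ?ltW// -HG// PE HG//; lra.
have [h [m [n [[Hh Qe'] h1 h2 h3]]]] := model_ends Qe.
have [m0 n0] := ends_uniq Qe Qe'; subst m n.
apply: (plg_ext gH Hh); apply: (@periodic_ext _ _ a) => //; first exact: plg_per Hh.
move=> x /andP[ax xa]; have [xb|bx] := lt_or_le x b.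
  have [|t tE] := @lam_onto R (pli kappa x).
    by apply/andP; split; rewrite -(plS kappa) pliK.
  by rewrite -[x](pliK kappa) -tE h1 QE.
have xO : b <= x <= a + 1 by rewrite bx.
rewrite Fid; last by rewrite (le_trans _ bx) ?ltW// (le_lt_trans xa) ?ltrD2r.
by case: (gO xO) => gx; [rewrite h2|rewrite h3].
Qed.

End Model.
End Fin.

(** * Covering the circle by arcs *)

Section Cover.
Context {R : realType}.
Implicit Types (a b c d e x y t : R) (F G f g h : pl R) (m n : int).

Lemma floor_cell a x : exists n : int, a + n%:~R <= x < a + n%:~R + 1.
Proof.
exists (Num.floor (x - a)).
by have /andP[] := floor_itv (x - a); rewrite intrD => h1 h2; apply/andP; split; lra.
Qed.

(** * Periodic extension from one period *)

Section Periodize.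
Variables (F : pl R) (a : R).
Hypotheses (da : dyad a) (Fa : F (a + 1) = F a + 1).

Let per x := F (x - (Num.floor (x - a))%:~R) + (Num.floor (x - a))%:~R.
Let peri y := pli F (y - (Num.floor (y - F a))%:~R) + (Num.floor (y - F a))%:~R.

Let floorE b x n : b + n%:~R <= x < b + n%:~R + 1 -> Num.floor (x - b) = n.
Proof. by move=> /andP[h1 h2]; apply: floor_def; rewrite intrD; lra. Qed.

Let perE n x : a + n%:~R <= x <= a + n%:~R + 1 -> per x = F (x - n%:~R) + n%:~R.
Proof.
move=> /andP[h1 h2]; have [h3|h3] := lt_or_le x (a + n%:~R + 1).
  by rewrite /per (@floorE _ _ n)// h1.
have -> : x = a + n%:~R + 1 by lra.
rewrite /per (@floorE _ _ (n + 1)) ?intrD; last by apply/andP; split; lra.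
have -> : a + n%:~R + 1 - (n%:~R + 1) = a by lra.
have -> : a + n%:~R + 1 - n%:~R = a + 1 by lra.
by rewrite Fa; lra.
Qed.

Let per_cell n x : a + n%:~R <= x < a + n%:~R + 1 ->
  F a + n%:~R <= per x < F a + n%:~R + 1.
Proof.
move=> /andP[h1 h2]; rewrite (@perE n); last by rewrite h1 ltW.
have f1 : F a <= F (x - n%:~R) by rewrite pl_mono; lra.
have f2 : F (x - n%:~R) < F a + 1 by rewrite -Fa plS; lra.
by apply/andP; split; lra.
Qed.

Let perK : cancel per peri.
Proof.
move=> x; have [n xn] := floor_cell a x.
rewrite /peri (floorE (per_cell xn)) (@perE n) ?addrK ?plK ?subrK//.
by move: xn => /andP[-> /ltW].
Qed.

Let periK : cancel peri per.
Proof.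
move=> y; have [n yn] := floor_cell (F a) y.
rewrite /peri (floorE yn); set x := pli F _ + _.
have xn : a + n%:~R <= x <= a + n%:~R + 1.
  move: yn => /andP[y1 y2].
  have f1 : a <= pli F (y - n%:~R) by rewrite -(pl_mono F) pliK; lra.
  have f2 : pli F (y - n%:~R) <= a + 1 by rewrite -(pl_mono F) pliK Fa; lra.
  by apply/andP; split; rewrite /x; lra.
by rewrite (perE xn) /x addrK pliK subrK.
Qed.

Let per_mono : {mono per : x y / x <= y}.
Proof.
apply: mono_of_incr => x y xy.
have [n xn] := floor_cell a x; have [m ym] := floor_cell a y.
have [nm|mn|nm] := ltgtP n m.
- have /andP[_ px] := per_cell xn; have /andP[py _] := per_cell ym.
  have : n%:~R + 1 <= m%:~R :> R by rewrite -[1]/(1%:~R) -intrD ler_int lezD1.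
  by lra.
- have : m%:~R + 1 <= n%:~R :> R by rewrite -[1]/(1%:~R) -intrD ler_int lezD1.
  by move: xn ym => /andP[x1 x2] /andP[y1 y2]; lra.
- subst m; rewrite (@perE n x) ?(@perE n y) ?ltrD2r ?plS ?ltrD2r//.
    by move: ym => /andP[-> /ltW].
  by move: xn => /andP[-> /ltW].
Qed.

Let cellpl n : pl R := plcomp (plsh (dyad_int n)) (plcomp F (plsh (dyad_int (- n)))).

Let cellplE n x : a + n%:~R <= x <= a + n%:~R + 1 -> cellpl n x = per x.
Proof. by move=> xn; rewrite (perE xn) /cellpl /plcomp/= !mul1r rmorphN. Qed.

Let per_germ x : germ per x.
Proof.
have [n /andP[xn nx]] := floor_cell a x.
have [an|an|ax] := ltgtP (a + n%:~R) x; last 2 first.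
- lra.
- apply: (@germ_glue _ (cellpl (n - 1)) (cellpl n) _ 1 x) => //; try exact: pl_germ.
  + by rewrite -ax; apply: dyadD => //; exact: dyad_int.
  + move=> y yx; rewrite cellplE//; move: yx; rewrite -ax intrB => /andP[y1 y2].
    by apply/andP; split; lra.
  + move=> y yx; rewrite cellplE//; move: yx; rewrite -ax => /andP[y1 y2].
    by apply/andP; split; lra.
apply: (@germ_near _ (cellpl n) _ (Num.min (x - (a + n%:~R)) (a + n%:~R + 1 - x))).
- by rewrite lt_min; apply/andP; split; lra.
- move=> y /andP[y1 y2]; rewrite cellplE//.
  have m1 : Num.min (x - (a + n%:~R)) (a + n%:~R + 1 - x) <= x - (a + n%:~R) by rewrite ge_min lexx.
  have m2 : Num.min (x - (a + n%:~R)) (a + n%:~R + 1 - x) <= a + n%:~R + 1 - x by rewrite ge_min lexx orbT.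
  by apply/andP; split; lra.
- exact: pl_germ.
Qed.

(** Translates of the restriction to [a, a + 1] are put side by side. New breakpoints can arise only
    at the translates of a, which is why a is dyadic. *)
Lemma periodize : exists P : pl R, periodic P /\ (forall x, a <= x <= a + 1 -> P x = F x).
Proof.
exists (PL perK periK per_mono per_germ); split=> [x|x xa] /=; last first.
  by rewrite (@perE 0) ?addr0// subr0.
have [n xn] := floor_cell a x; move: (xn) => /andP[x1 x2].
rewrite (@perE (n + 1)) ?intrD ?(@perE n); [|by apply/andP; split; lra|by apply/andP; split; lra].
by rewrite addrA; have -> : x + 1 - (n%:~R + 1) = x - n%:~R by lra.
Qed.

End Periodize.

Lemma dyad_between_min a x y : a < x -> a < y -> exists d, [/\ dyad d, a < d, d < x & d < y].
Proof.
move=> ax ay; have [|d dd /andP[d1 d2]] := @dyad_dense R a (Num.min x y).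
  by rewrite lt_min ax ay.
by exists d; move: d2; rewrite lt_min => /andP[].
Qed.

Lemma dyad_between_max a x y : x < a -> y < a -> exists d, [/\ dyad d, d < a, x < d & y < d].
Proof.
move=> ax ay; have [|d dd /andP[d1 d2]] := @dyad_dense R (Num.max x y) a.
  by rewrite gt_max ax ay.
by exists d; move: d1; rewrite gt_max => /andP[].
Qed.

(** Dyadic marks a' < y1 < y < y2 < b' are chosen: the map interpolates from the identity at a' to f
    at y1, equals f on [y1, y2], and interpolates back to the identity at b'. *)
Lemma local_ext f a b y : b <= a + 1 -> a < y < b -> a < f y < b ->
  exists h a' b' e, [/\ periodic h, a < a' /\ b' < b, 0 < e,
    forall x, b' <= x <= a' + 1 -> h x = x &
    forall x, y - e < x < y + e -> h x = f x].
Proof.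
move=> ba /andP[ay yb] /andP[afy fyb].
have [|y1 [dy1 y1y ay1 fay1]] := @dyad_between_max y a (pli f a) ay.
  by rewrite -(plS f) pliK.
have [|y2 [dy2 yy2 y2b y2fb]] := @dyad_between_min y b (pli f b) yb.
  by rewrite -(plS f) pliK.
rewrite -(plS f) pliK in fay1; rewrite -(plS f) pliK in y2fb.
have [a' [da' aa' a'y a'fy]] := dyad_between_min ay1 fay1.
have [b' [db' b'b yb' fyb']] := dyad_between_max y2b y2fb.
have dfy1 : dyad (f y1) by apply/pl_dyad.
have dfy2 : dyad (f y2) by apply/pl_dyad.
have [P1 [P1a P1b]] := plpath da' dy1 da' dfy1 a'y a'fy.
have [P2 [P2a P2b]] := plpath dy2 db' dfy2 db' yb' fyb'.
have y12 : f y1 < f y2 by rewrite plS; light_lra.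
have [|Q1 [L1 R1]] := @plglue_ex R plid P1 _ da'; first by rewrite plidE P1a.
have [|Q2 [L2 R2]] := @plglue_ex R Q1 f _ dy1; first by rewrite R1 ?P1b//; light_lra.
have [|Q3 [L3 R3]] := @plglue_ex R Q2 P2 _ dy2; first by rewrite R2 ?P2a//; light_lra.
have [|Q [L4 R4]] := @plglue_ex R Q3 plid _ db'; first by rewrite R3 ?P2b ?plidE//; light_lra.
have Qa : Q a' = a' by rewrite L4 ?L3 ?L2 ?L1 ?plidE//; light_lra.
have Qa1 : Q (a' + 1) = Q a' + 1 by rewrite R4 ?plidE ?Qa//; light_lra.
have [h [ph hQ]] := periodize da' Qa1.
exists h, a', b', (Num.min (y - y1) (y2 - y)); split => //.
- by rewrite lt_min; apply/andP; split; light_lra.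
- move=> x /andP[x1 x2]; rewrite hQ ?R4 ?plidE//; apply/andP; split; light_lra.
- move=> x /andP[].
  have m1 : Num.min (y - y1) (y2 - y) <= y - y1 by rewrite ge_min lexx.
  have m2 : Num.min (y - y1) (y2 - y) <= y2 - y by rewrite ge_min lexx orbT.
  move=> x1 x2; rewrite hQ; last by apply/andP; split; light_lra.
  by rewrite L4 ?L3 ?R2//; light_lra.
Qed.

(** * Fragmentation of maps along overlapping arcs *)

Section GoodArcs.
Variable H : pl R -> Prop.
Hypothesis gH : plgroup H.

Lemma good_sub a b a' b' : a <= a' -> b' <= b -> good H a b -> good H a' b'.
Proof.
move=> aa bb Hab F pF a1 b1 h1 h2; apply: Hab => //; first exact: le_lt_trans h1.
exact: lt_le_trans bb.
Qed.

Lemma good_image h a b : H h -> good H a b -> good H (pli h a) (pli h b).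
Proof.
move=> Hh Hab F pF a' b' aa bb Fid.
have ph := plg_per gH Hh.
have HG : H (plcomp h (plcomp F (plinv h))).
  apply: (Hab _ _ (h a') (h b')).
  - by do 2!apply: periodic_comp => //; exact: periodic_inv.
  - by rewrite -(plS h) pliK in aa.
  - by rewrite -(plS h) pliK in bb.
  - move=> x /andP[x1 x2] /=; rewrite Fid ?pliK// -(pl_mono h) pliK x1/=.
    by rewrite -(pl_mono h) pliK ph.
apply: (plg_ext gH (plg_comp gH (plg_inv gH Hh) (plg_comp gH HG Hh))) => x.
by rewrite /= !plK.
Qed.

(* A map supported in the arc from [a] to [d] that is the identity near [y]
   is a product of maps supported on either side of [y]. *)
Lemma good_split a b c d y k A B e : c < y < b -> dyad y -> a < A -> B < d -> d <= a + 1 ->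
  0 < e -> a <= c -> b <= d -> good H a b -> good H c d -> periodic k ->
  (forall x, B <= x <= A + 1 -> k x = x) ->
  (forall x, y - e < x < y + e -> k x = x) -> H k.
Proof.
move=> /andP[cy yb] dy aA Bd da e0 ac bd gab gcd pk kAB ky.
wlog e1 : e e0 ky / e <= 1.
  move=> wl; have m1 : Num.min e 1 <= e by rewrite ge_min lexx.
  apply: (wl (Num.min e 1)); [by rewrite lt_min e0 ltr01| |by rewrite ge_min lexx orbT].
  by move=> x xe; apply: ky; light_lra.
wlog AB : A B aA Bd kAB / A <= y <= B.
  move=> wl; apply: (wl (Num.min A y) (Num.max B y)).
  - by rewrite lt_min aA; light_lra.
  - by rewrite gt_max Bd; light_lra.
  - move=> x; rewrite ge_max => /andP[/andP[x1 x2] x3]; apply: kAB; rewrite x1 (le_trans x3)//.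
    by rewrite lerD2r ge_min lexx.
  - by rewrite ge_min lexx orbT le_max lexx orbT.
move: AB => /andP[Ay yB].
(* The circle is cut at two points fixed by k, namely y and a point z outside the support. [K1]
   follows k on [y, z] and [K2] follows it on [z, y + 1]. *)
have [z dz /andP[Bz zA]] : exists2 z, dyad z & B < z < A + 1 by apply: dyad_dense; light_lra.
have kz : k z = z by rewrite kAB//; light_lra.
have kyy : k y = y by rewrite ky//; light_lra.
have yz : y <= z by light_lra.
have [|Q1 [L1 R1]] := @plglue_ex R k plid z dz; first by rewrite plidE.
have [|Q2 [L2 R2]] := @plglue_ex R plid k z dz; first by rewrite plidE.
have ky1 : k (y + 1) = y + 1 by rewrite pk kyy.
have [|K1 [pK1 K1E]] := @periodize Q1 y dy; first by rewrite R1 ?plidE ?L1 ?kyy//; light_lra.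
have [|K2 [pK2 K2E]] := @periodize Q2 y dy; first by rewrite R2 ?ky1 ?L2 ?plidE//; light_lra.
have K1L x : y <= x <= z -> K1 x = k x.
  by move=> /andP[x1 x2]; rewrite K1E ?L1//; light_lra.
have K1R x : z <= x <= y + 1 -> K1 x = x.
  by move=> /andP[x1 x2]; rewrite K1E ?R1 ?plidE//; light_lra.
have K2L x : y <= x <= z -> K2 x = x.
  by move=> /andP[x1 x2]; rewrite K2E ?L2 ?plidE//; light_lra.
have K2R x : z <= x <= y + 1 -> K2 x = k x.
  by move=> /andP[x1 x2]; rewrite K2E ?R2//; light_lra.
have HK1 : H K1.
  apply: (gcd K1 pK1 (y + e / 2) B) => //; first light_lra.
  move=> x /andP[x1 x2]; have [xz|zx] := le_or_lt x z.
    by rewrite K1L ?kAB//; light_lra.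
  have [xy|yx] := le_or_lt x (y + 1); first by rewrite K1R//; light_lra.
  have [xz|zx'] := le_or_lt (x - 1) z; last by apply: (@addIr _ (- 1)); rewrite -periodicB// K1R//; light_lra.
  by apply: (@addIr _ (- 1)); rewrite -periodicB// K1L ?ky//; light_lra.
have HK2 : H K2.
  apply: (gab K2 pK2 A (y - e / 2)) => //; first light_lra.
  move=> x /andP[x1 x2]; have [xy|yx] := le_or_lt y x.
    have [xz|zx] := le_or_lt x z; first by rewrite K2L//; light_lra.
    by rewrite K2R ?kAB//; light_lra.
  have [xz|zx'] := le_or_lt (x + 1) z; first by apply: (@addIr _ 1); rewrite -pK2 K2L//; light_lra.
  by apply: (@addIr _ 1); rewrite -pK2 K2R ?pk ?ky//; light_lra.
apply: (plg_ext gH (plg_comp gH HK2 HK1)).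
apply: (@periodic_ext _ _ _ y) => //; first exact: periodic_comp.
move=> x /andP[x1 x2] /=; have [xz|zx] := le_or_lt x z.
  rewrite K1L ?K2L//; last by light_lra.
  by apply/andP; split; [rewrite -[leLHS]kyy|rewrite -[leRHS]kz]; rewrite pl_mono; light_lra.
by rewrite K1R ?K2R//; light_lra.
Qed.

(** For y in the overlap, F y lies in ]a, b[ or in ]c, d[, so some h supported in one of these arcs
    agrees with F near y. Then h^-1 F is the identity near y and [good_split] applies to it. *)
Lemma good_union a b c d : a <= c -> c < b -> b <= d -> d <= a + 1 ->
  good H a b -> good H c d -> good H a d.
Proof.
move=> ac cb bd da gab gcd F pF a' b' aa bd' Fid.
have [y dy /andP[cy yb]] := dyad_dense cb.
have Fa : F a = a by apply: (@addIr _ 1); rewrite -pF Fid//; light_lra.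
have Fd : F d = d by rewrite Fid//; light_lra.
have Fy : a < F y < d by apply/andP; split; [rewrite -[ltLHS]Fa|rewrite -[ltRHS]Fd]; rewrite plS; light_lra.
have [h [ah [bh [e [ph Hh e0 [ha hb] [hid hF]]]]]] : exists h ah bh e,
    [/\ periodic h, H h, 0 < e, a < ah /\ bh < d &
    (forall x, bh <= x <= ah + 1 -> h x = x) /\
    (forall x, y - e < x < y + e -> h x = F x)].
  move: Fy => /andP[aFy Fyd]; have [Fyb|bFy] := lt_or_le (F y) b.
    have [|||h [ah [bh [e [ph [ha hb] e0 hid hF]]]]] := @local_ext F a b y; try light_lra.
    exists h, ah, bh, e; split => //; first exact: gab ha hb hid.
    by split => //; exact: lt_le_trans bd.
  have [|||h [ah [bh [e [ph [ha hb] e0 hid hF]]]]] := @local_ext F c d y; try light_lra.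
  exists h, ah, bh, e; split => //; first exact: gcd ha hb hid.
  by split => //; exact: le_lt_trans ha.
have Hk : H (plcomp (plinv h) F).
  apply: (@good_split a b c d y _ (Num.min a' ah) (Num.max b' bh) e) => //.
  - by rewrite cy.
  - by rewrite lt_min aa.
  - by rewrite gt_max bd'.
  - by apply: periodic_comp => //; exact: periodic_inv.
  - move=> x; rewrite ge_max => /andP[/andP[x1 x2] x3].
    have m1 : Num.min a' ah <= a' by rewrite ge_min lexx.
    have m2 : Num.min a' ah <= ah by rewrite ge_min lexx orbT.
    apply: (pl_inj (F := h)); rewrite [LHS]pliK Fid ?hid//; light_lra.
  - by move=> x xe; apply: (pl_inj (F := h)); rewrite [LHS]pliK hF.
by apply: (plg_ext gH (plg_comp gH Hh Hk)) => x; exact: pliK.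
Qed.

Lemma plg_int m : H (plsh (dyad_int m)).
Proof.
exact: (gen_int (plg_ext gH) (plg_comp gH) (plg_inv gH) (plg_sh gH)).
Qed.

Section Covering.
Variables (a b : R).
Hypotheses (gab : good H a b) (cover : forall x, exists2 h, H h & a < h x < b).

Lemma good_nbhd x : exists2 e, 0 < e & good H (x - e) (x + e).
Proof.
have [h Hh /andP[ah hb]] := cover x.
rewrite -[a](pliK h) plS in ah; rewrite -[b](pliK h) plS in hb.
exists (Num.min (x - pli h a) (pli h b - x)); first by rewrite lt_min !subr_gt0 ah.
have m1 : Num.min (x - pli h a) (pli h b - x) <= x - pli h a by rewrite ge_min lexx.
have m2 : Num.min (x - pli h a) (pli h b - x) <= pli h b - x by rewrite ge_min lexx orbT.
by apply: good_sub (good_image Hh gab); lra.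
Qed.

Lemma good_circle x : good H x (x + 1).
Proof.
have [e e0 gx] := good_nbhd x.
pose d := Num.min (e / 2) 1.
have d1 : d <= e / 2 by rewrite ge_min lexx.
have d2 : d <= 1 by rewrite ge_min lexx orbT.
have d0 : 0 < d by rewrite lt_min ltr01 divr_gt0.
(* The arc grows to the right by [good_union]. Starting from x + d keeps the left end of every added
   arc at or beyond x. *)
apply: (@real_ind R (good H x) (x + d)); first lra.
  by apply: good_sub gx; lra.
move=> s /andP[s1 s2]; have [e' e'0 gs] := good_nbhd s.
exists (Num.min e' d) => [|u v xu su uv vs vx gu]; first by rewrite lt_min e'0.
have m1 : Num.min e' d <= e' by rewrite ge_min lexx.
have m2 : Num.min e' d <= d by rewrite ge_min lexx orbT.
apply: (@good_union x u (s - Num.min e' d) v) => //; first lra.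
by apply: good_sub gs; lra.
Qed.

(** A general f is not supported in an arc [x, x + 1], so [good_circle] is applied twice: after an
    integer translation of f, to a map h that agrees with it near 0, and to their quotient, which is
    the identity near 0. *)
Theorem cover_all f : periodic f -> H f.
Proof.
move=> pf; pose m := - Num.floor (f 0).
have pF : periodic (plcomp (plsh (dyad_int m)) f).
  by apply: periodic_comp => // x; rewrite !plshE; lra.
suff HF : H (plcomp (plsh (dyad_int m)) f).
  by apply: (plg_ext gH (plg_comp gH (plg_inv gH (plg_int m)) HF)) => x; exact: plK.
have F0 : plcomp (plsh (dyad_int m)) f 0 = f 0 + m%:~R by rewrite /= mul1r.
move: (plcomp _ f) pF F0 => F pF F0; have /andP[f1 f2] := floor_itv (f 0).
rewrite intrD in f2; rewrite /m rmorphN/= in F0.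
have [F1 F2] : 0 <= F 0 /\ F 0 < 1 by lra.
(* The midpoint of F 0 - 1 and 0: both 0 and F 0 are then interior to [c, c + 1]. *)
pose c := (F 0 - 1) / 2.
have [|||h [a' [b' [e [ph [h1 h2] e0 hid hF]]]]] := @local_ext F c (c + 1) 0; rewrite /c; try lra.
have Hh : H h by have gc : good H c (c + 1) := @good_circle c; apply: (gc h ph a' b' h1 h2 hid).
have Hk : H (plcomp (plinv h) F).
  have gc : good H 0 (0 + 1) := @good_circle 0.
  apply: (gc _ _ (e / 2) (1 - e / 2)).
  - by apply: periodic_comp => //; exact: periodic_inv.
  - lra.
  - lra.
  - move=> x /andP[x1 x2]; apply: (pl_inj (F := h)); rewrite [LHS]pliK.
    by apply: (@addIr _ (-1)); rewrite -!periodicB// hF//; lra.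
by apply: (plg_ext gH (plg_comp gH Hh Hk)) => x; exact: pliK.
Qed.

End Covering.
End GoodArcs.
End Cover.

(** * Elements that are not involutions *)

Section Cases.
Context {R : realType}.
Implicit Types (a b c d e x y t : R) (F G f g h : pl R) (m n : int).

Definition movable (H : pl R -> Prop) a b x := exists2 h, H h & a < h x < b.

Lemma movable_id H a b x : plgroup H -> a < x < b -> movable H a b x.
Proof. by move=> gH xab; exists (plsh (dyad_int 0)); [exact: plg_int|rewrite plshE addr0]. Qed.

Lemma movable_step H a b h x : plgroup H -> H h -> movable H a b (h x) -> movable H a b x.
Proof. by move=> gH Hh [k Hk kx]; exists (plcomp k h) => //; exact: plg_comp. Qed.

Lemma movable_stepV H a b h x : plgroup H -> H h -> movable H a b (pli h x) -> movable H a b x.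
Proof. by move=> gH Hh; apply: (@movable_step _ _ _ (plinv h)) => //; exact: plg_inv. Qed.

Lemma movable_int H a b x m : plgroup H -> movable H a b (x + m%:~R) -> movable H a b x.
Proof.
by move=> gH; rewrite -(plshE (dyad_int m)); apply: movable_step => //; exact: plg_int.
Qed.

Lemma movableB1 H a b x : plgroup H -> movable H a b x -> movable H a b (x + 1).
Proof. by move=> gH xm; apply: (@movable_int _ _ _ _ (-1)) => //; rewrite rmorphN/= addrK. Qed.

Lemma tau_itv (s : R) : 2^-1 <= s <= 1 -> 0 <= tau s <= 7 / 8.
Proof. by move=> /andP[s1 s2]; rewrite -tau_half -tau_1 !pl_mono s1. Qed.

Lemma taui_itv y : 0 <= y <= 7 / 8 -> 2^-1 <= pli tau y <= 1.
Proof.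
by move=> yy; apply/andP; split; rewrite -(pl_mono tau) pliK ?tau_half ?tau_1; order_lra.
Qed.

Lemma bump_half : bump 2^-1 = 2^-1 :> R. Proof. by rewrite bump_id; order_lra. Qed.
Lemma bump_1 : bump 1 = 1 :> R. Proof. by rewrite bump_id; order_lra. Qed.

Lemma bump_itv (s : R) : 2^-1 <= s <= 1 -> 2^-1 <= bump s <= 1.
Proof.
by move=> /andP[s1 s2]; apply/andP; split; [rewrite -[leLHS]bump_half|rewrite -[leRHS]bump_1]; rewrite pl_mono.
Qed.

Lemma dyad78 : dyad (7 / 8 : R).
Proof. by exists 7, 3%N; field. Qed.

(** Each group of lifts here contains the unit translation, so this is generation modulo integer
    translations, that is, in T. *)
Definition generates f g := forall H, plgroup H -> H f -> H g ->
  forall h, periodic h -> H h.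

Lemma dyad_next a c : a < c -> exists d, [/\ dyad d, a < d & d < c].
Proof. by move=> /dyad_dense[d dd /andP[]]; exists d. Qed.

(* With A1 = [p', q'] and A2 = [al d, al e], [be] exchanges A1 and A2, as well
   as the two gaps between them; [g1] is the square of [be] and [g2] its
   conjugate by [al].  The marks [y2] and [m'] make [be] send all of the gap
   from A2 to A1, except an end where [al] is under control, to points that
   [al] maps into the arc K = ]al p', al e[. *)
Lemma generate_noninvolution al x : periodic al -> x < al x -> al x < al (al x) ->
  al (al x) < x + 1 ->
  exists2 be, periodic be & generates al be.
Proof.
move=> pal xax axx axx1.
have [r [dr xr rax rr]] : exists r, [/\ dyad r, x < r, r < al x & al (al r) < x + 1].
  have [|r [dr xr rax rr]] := @dyad_between_min R x (al x) (pli al (pli al (x + 1))) xax.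
    by rewrite -2!(plS al) !pliK.
  by exists r; split => //; rewrite -2!(plS al) !pliK in rr.
have [y2 [dy2 xy2 y2r]] := dyad_next xr.
have [p' [dp' y2p' p'r]] := dyad_next y2r.
have [d [dd p'd dr']] := dyad_next p'r.
have [q' [dq' dq'' q'r]] := dyad_next dr'.
have [m' [dm' q'm' m'r]] := dyad_next q'r.
have [e [de m'e er]] := dyad_next m'r.
clear dr.
have o1 : al x < al p' by rewrite plS; order_lra.
have o2 : al p' < al d by rewrite plS.
have o3 : al d < al q' by rewrite plS.
have o4 : al q' < al e by rewrite plS; order_lra.
have o5 : al e < al (al x) by rewrite plS; order_lra.
have o6 : al (al p') < al (al e) by rewrite !plS; order_lra.
have o7 : al (al e) < x + 1 by rewrite (lt_trans _ rr)// !plS.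
have alx : al x < x + 1 by clear - axx axx1; order_lra.
have qx : al e < x + 1 by clear - o5 axx1; order_lra.
clear y2r p'r dr' q'r m'r rr axx axx1 xr.
have dp1 : dyad (al p') by apply/pl_dyad.
have dp : dyad (al d) by apply/pl_dyad.
have dq1 : dyad (al q') by apply/pl_dyad.
have dq : dyad (al e) by apply/pl_dyad.
have dp'1 : dyad (p' + 1) by apply: dyadD => //; exact: dyad1.
have dy21 : dyad (y2 + 1) by apply: dyadD => //; exact: dyad1.
(* The chart of K: the supports [1/2, 1] of [bump] and [0, 7/8] of [bump_conj] correspond to A2 and
   al(A1). *)
have [ka [k0 ks]] : exists ka : pl R, ka 0 = al p' /\ [/\ ka 2^-1 = al d, ka (7 / 8) = al q' & ka 1 = al e].
  have [|ka [k0 ks]] := @plpaths R 0 2^-1 (al p') (al d) [:: (7 / 8, al q'); (1, al e)] dyad0 dp1.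
    have [h0 h1 h2] : [/\ 0 < 2^-1 :> R, 2^-1 < 7 / 8 :> R & 7 / 8 < 1 :> R] by split; order_lra.
    by do ![split => //=; try exact: dyad_half; try exact: dyad78; try exact: dyad1].
  by exists ka; split => //; split; [apply: (ks (_, _))|apply: (ks (_, _))|apply: (ks (_, _))]; rewrite /=; auto.
case: ks => k1 k2 k3.
have [si [s0 s1 s2]] : exists si : pl R, [/\ si q' = al e, si m' = y2 + 1 & si (al d) = p' + 1].
  have [|si [s0 ss]] := @plpaths R q' m' (al e) (y2 + 1) [:: (al d, p' + 1)] dq' dq.
    by do ![split => //=; try order_lra].
  by exists si; split => //; [apply: (ss (_, _))|apply: (ss (_, _))]; rewrite /=; auto.
have tk : pli tau (7 / 8) = 1 :> R by rewrite -tau_1 plK.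
have t0 : pli tau 0 = 2^-1 :> R by rewrite -tau_half plK.
(* [B1] carries A1 to A2 through the inverse of [tau], and [B3] applies [bump] before carrying A2
   back. So in the chart the square of [be] is [bump] on A2, and its conjugate by [al] is [bump]
   conjugated by [tau] on al(A1). On the gaps, [si] and [B4] undo each other up to one turn. *)
pose B1 := plcomp ka (plcomp (plinv tau) (plcomp (plinv ka) al)).
pose B3 := plcomp (plsh dyad1) (plcomp (plinv al) (plcomp ka (plcomp tau (plcomp bump (plinv ka))))).
pose B4 := plcomp (plsh dyad1) (plinv si).
have B1E z : B1 z = ka (pli tau (pli ka (al z))) by [].
have B3E z : B3 z = pli al (ka (tau (bump (pli ka z)))) + 1 by exact: plshE.
have B4E z : B4 z = pli si z + 1 by exact: plshE.
have [|Q1 [L1 R1]] := @plglue_ex R B1 si q' dq'.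
  by rewrite B1E -k2 plK tk k3 s0.
have [|Q2 [L2 R2]] := @plglue_ex R Q1 B3 (al d) dp.
  rewrite R1; last by order_lra.
  by rewrite s2 B3E -k1 plK bump_half tau_half k0 plK.
have [|Q3 [L3 R3]] := @plglue_ex R Q2 B4 (al e) dq.
  rewrite R2; last by order_lra.
  by rewrite B3E -k3 plK bump_1 tau_1 k2 plK B4E k3 -s0 plK.
have [|be [pbe beE]] := @periodize R Q3 p' dp'.
  rewrite R3; last by order_lra.
  rewrite B4E -s2 plK L3 ?L2 ?L1; try order_lra.
  by rewrite B1E -k0 plK t0 k1.
have be1 z : p' <= z <= q' -> be z = ka (pli tau (pli ka (al z))).
  by move=> /andP[z1 z2]; rewrite beE ?L3 ?L2 ?L1 ?B1E//; order_lra.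
have be2 z : q' <= z <= al d -> be z = si z.
  by move=> /andP[z1 z2]; rewrite beE ?L3 ?L2 ?R1//; order_lra.
have be3 z : al d <= z <= al e -> be z = pli al (ka (tau (bump (pli ka z)))) + 1.
  by move=> /andP[z1 z2]; rewrite beE ?L3 ?R2 ?B3E//; order_lra.
have be4 z : al e <= z <= p' + 1 -> be z = pli si z + 1.
  by move=> /andP[z1 z2]; rewrite beE ?R3 ?B4E//; order_lra.
clear Q1 L1 R1 Q2 L2 R2 Q3 L3 R3 B1 B3 B4 B1E B3E B4E beE.
exists be => // H gH Hal Hbe.
(* The lift [be] applied twice goes once around the circle, which the translation by -1 corrects. *)
pose g1 := plcomp (plsh (dyad_int (-1))) (plcomp be be).
have g1E z : g1 z = be (be z) - 1 by exact: (plshE (dyad_int (-1))).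
have Hg1 : H g1 by do ?apply: plg_comp => //; exact: plg_int.
have pg1 : periodic g1 := plg_per gH Hg1.
pose g2 := plcomp al (plcomp g1 (plinv al)).
have g2E z : g2 z = al (g1 (pli al z)) by [].
have Hg2 : H g2 by do ?apply: plg_comp => //; exact: plg_inv.
clearbody g1 g2.
have gapA z : q' <= z <= al d -> al e <= si z <= p' + 1 by rewrite -s0 -s2 !pl_mono.
have gapB z : al e <= z <= p' + 1 -> q' <= pli si z <= al d.
  by move=> /andP[z1 z2]; apply/andP; split; rewrite -(pl_mono si) pliK ?s0 ?s2.
have g1A z : q' <= z <= al d -> g1 z = z.
  by move=> zz; rewrite g1E (be2 _ zz) (be4 _ (gapA _ zz)) plK addrK.
have g1B z : al e <= z <= p' + 1 -> g1 z = z.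
  by move=> zz; rewrite g1E (be4 _ zz) pbe (be2 _ (gapB _ zz)) pliK addrK.
have wE y : 2^-1 <= y <= 1 -> p' <= pli al (ka (tau y)) <= q'.
  move=> /tau_itv /andP[t1 t2]; apply/andP; split; rewrite -(pl_mono al) pliK.
    by rewrite -k0 pl_mono.
  by rewrite -k2 pl_mono.
have kI y : 2^-1 <= y <= 1 -> al d <= ka y <= al e by rewrite -k1 -k3 !pl_mono.
have be3k y : 2^-1 <= y <= 1 -> be (ka y) = pli al (ka (tau (bump y))) + 1.
  by move=> yy; rewrite be3 ?plK//; exact: kI.
have be1k y : 2^-1 <= y <= 1 -> be (pli al (ka (tau y))) = ka y.
  by move=> yy; rewrite be1 ?pliK ?plK//; exact: wE.
have g1k y : 0 <= y <= 1 -> g1 (ka y) = ka (bump y).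
  move=> /andP[y1 y2']; have [yh|hy] := le_or_lt y 2^-1.
    rewrite bump_id; last by left.
    have h1 : al p' <= ka y by rewrite -k0 pl_mono.
    have h2 : ka y <= al d by rewrite -k1 pl_mono.
    by rewrite g1A//; order_lra.
  have yy : 2^-1 <= y <= 1 by order_lra.
  by rewrite g1E (be3k _ yy) pbe addrK be1k//; exact: bump_itv.
have g2k y : 0 <= y <= 1 -> g2 (ka y) = ka (bump_conj y).
  move=> /andP[y1 y2']; have [yh|hy] := le_or_lt y (7 / 8).
    have ss := @taui_itv y ltac:(order_lra).
    by rewrite -[y](pliK tau) bump_conj_tau g2E g1E (be1k _ ss) (be3k _ ss) addrK pliK.
  rewrite bump_conj_id; last by right; exact: ltW.
  have h1 : q' <= pli al (ka y) by rewrite -(pl_mono al) pliK -k2 pl_mono ltW.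
  have h2 : pli al (ka y) <= e by rewrite -(pl_mono al) pliK -k3 pl_mono.
  by rewrite g2E g1A ?pliK//; order_lra.
have gab : good H (ka 0) (ka 1).
  apply: (model_good gH Hg1 Hg2 _ g1k g2k); rewrite k0 k3; first by order_lra.
  (* Outside K, [g1] moves only points of A1 + 1, and this arc comes after al(A2) and before al(A1)
     + 1, where [g2] is trivial. *)
  move=> z /andP[z1 z2]; have [zp|pz] := le_or_lt z (p' + 1).
    by left; rewrite g1B// z1.
  have [zq|qz] := le_or_lt z (q' + 1).
    right; rewrite g2E g1B ?pliK//.
    have h1 : al e <= pli al z by rewrite -(pl_mono al) pliK; order_lra.
    have h2 : pli al z <= p' + 1 by rewrite -(pl_mono al) pliK pal; order_lra.
    by rewrite h1.
  by left; apply: (@addIr _ (-1)); rewrite -periodicB// g1A//; order_lra.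
(* Each claim feeds the next: [al] maps ]p', e[ into K; up to a turn, [be] maps [al e, y2 + 1] into
   ]p', e[; [al] maps [e, al p'] into [al e, y2 + 1]; up to a turn, [be] maps the remaining part of
   the second gap into the first. *)
have mv1 z : p' < z < e -> movable H (ka 0) (ka 1) z.
  move=> /andP[z1 z2]; apply: (@movable_step _ _ _ al) => //; apply: movable_id => //.
  by rewrite k0 k3 !plS z1.
have mv2 z : al e <= z <= y2 + 1 -> movable H (ka 0) (ka 1) z.
  move=> /andP[z1 z2]; apply: (@movable_step _ _ _ be) => //.
  rewrite be4; last by order_lra.
  apply: movableB1 => //; apply: mv1.
  have h1 : q' <= pli si z by rewrite -(pl_mono si) pliK s0.
  have h2 : pli si z <= m' by rewrite -(pl_mono si) pliK s1.
  by order_lra.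
have mv3 z : q' <= z <= al d -> movable H (ka 0) (ka 1) z.
  move=> /andP[z1 z2]; have [ze|ez] := lt_or_le z e; first by apply: mv1; order_lra.
  have [zp|pz] := le_or_lt z (al p').
    apply: (@movable_step _ _ _ al) => //; apply: mv2.
    have h1 : al e <= al z by rewrite pl_mono.
    have h2 : al z <= al (al p') by rewrite pl_mono.
    by order_lra.
  by apply: movable_id; rewrite // k0 k3; order_lra.
have mv4 z : y2 + 1 <= z <= p' + 1 -> movable H (ka 0) (ka 1) z.
  move=> /andP[z1 z2]; apply: (@movable_step _ _ _ be) => //.
  rewrite be4; last by order_lra.
  by apply: movableB1 => //; apply: mv3; apply: gapB; order_lra.
apply: (cover_all gH gab) => z.
have [m /andP[z1 z2]] := int_translate z p'.
apply: (@movable_int _ _ _ _ m) => //; move: (z + m%:~R) z1 z2 => {}z z1 z2.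
have [zq|qz] := le_or_lt z q'; first by apply: mv1; order_lra.
have [zd|dz] := le_or_lt z (al d); first by apply: mv3; order_lra.
have [ze|ez] := lt_or_le z (al e).
  by apply: movable_id; rewrite // k0 k3; order_lra.
have [zy|yz] := le_or_lt z (y2 + 1); first by apply: mv2; order_lra.
by apply: mv4; order_lra.
Qed.

End Cases.

(** * Involutions *)

Section Involution.
Context {R : realType}.
Implicit Types (a b c d e x y t : R) (F G f g h : pl R) (m n : int).

(* The arcs A1 = [c1, c2], A2 = [c6, c7] and A3 = [a4, a5] are permuted by [be]
   and so are the gaps between them; their images under [al] are
   [a1, a2], [a6, a7] and [c4 + 1, c5 + 1], one in each gap modulo 1.  Only the
   first of these meets the image under [be] of another one, [c4, c5], in the
   arc K = ]a1, l[. *)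
Lemma generate_involution al x : periodic al -> (forall z, al (al z) = z + 1) ->
  x < al x -> exists2 be, periodic be & generates al be.
Proof.
move=> pal aal xax.
have [c7 [dc7 xc7 c7x]] := dyad_next xax.
have [c1 [dc1 xc1 c17]] := dyad_next xc7.
have [c2 [dc2 c12 c27]] := dyad_next c17.
have [c3 [dc3 c23 c37]] := dyad_next c27.
have [c4 [dc4 c34 c47]] := dyad_next c37.
have [c5 [dc5 c45 c57]] := dyad_next c47.
have [c6 [dc6 c56 c67]] := dyad_next c57.
have [a1 a1E] : exists a1, al c1 = a1 by eexists.
have [a2 a2E] : exists a2, al c2 = a2 by eexists.
have [a3 a3E] : exists a3, al c3 = a3 by eexists.
have [a4 a4E] : exists a4, al c4 = a4 by eexists.
have [a5 a5E] : exists a5, al c5 = a5 by eexists.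
have [a6 a6E] : exists a6, al c6 = a6 by eexists.
have [a7 a7E] : exists a7, al c7 = a7 by eexists.
have xa1 : al x < a1 by rewrite -a1E plS.
have a12 : a1 < a2 by rewrite -a1E -a2E plS.
have a23 : a2 < a3 by rewrite -a2E -a3E plS.
have a34 : a3 < a4 by rewrite -a3E -a4E plS.
have a45 : a4 < a5 by rewrite -a4E -a5E plS.
have a56 : a5 < a6 by rewrite -a5E -a6E plS.
have a67 : a6 < a7 by rewrite -a6E -a7E plS.
have a7x : a7 < x + 1 by rewrite -aal -a7E plS.
have da1 : dyad a1 by rewrite -a1E; apply/pl_dyad.
have da2 : dyad a2 by rewrite -a2E; apply/pl_dyad.
have da4 : dyad a4 by rewrite -a4E; apply/pl_dyad.
have da5 : dyad a5 by rewrite -a5E; apply/pl_dyad.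
have dc11 : dyad (c1 + 1) by apply: dyadD => //; exact: dyad1.
have [k [dk a1k ka2]] := dyad_next a12.
have [l [dl a3l la4]] := dyad_next a34.
(* A mark beyond al(A2) = [a6, a7]. As [be] will send c3 to a1 and a1 to nn, it moves al(A1) past
   al(A2), and moves al(A2) before c3 + 1, away from [c4 + 1, c5 + 1]: no second crossing occurs. *)
have [nn [dnn a7n nc1]] : exists nn, [/\ dyad nn, a7 < nn & nn < c1 + 1].
  by apply: dyad_next; order_lra.
clear c17 c27 c37 c47 c57 xc7.
have kl : k < l by clear - ka2 a23 a3l; order_lra.
have a2l : a2 < l by clear - a23 a3l; order_lra.
have c7a1 : c7 < a1 by clear - c7x xa1; order_lra.
have c7a4 : c7 < a4 by clear - c7a1 a12 a23 a34; order_lra.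
have a14 : a1 < a4 by clear - a12 a23 a34; order_lra.
have a5n : a5 < nn by clear - a56 a67 a7n; order_lra.
have ali z : pli al z = al z - 1.
  by apply: (pl_inj (F := al)); rewrite pliK periodicB// aal addrK.
have [s1 [s1c2 s1c3 [s1c4 s1c5 s1c6]]] : exists s1 : pl R,
    [/\ s1 c2 = c7, s1 c3 = a1 & [/\ s1 c4 = k, s1 c5 = l & s1 c6 = a4]].
  have [|s [s0 ss]] := @plpaths R c2 c3 c7 a1 [:: (c4, k); (c5, l); (c6, a4)] dc2 dc7.
    by do ![split => //=].
  exists s; split => //; first by apply: (ss (_, _)); rewrite /=; auto.
  by split; apply: (ss (_, _)); rewrite /=; auto.
have [s2 [s2c7 s2a1 s2a4]] : exists s2 : pl R, [/\ s2 c7 = a5, s2 a1 = nn & s2 a4 = c1 + 1].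
  have [|s [s0 ss]] := @plpaths R c7 a1 a5 nn [:: (a4, c1 + 1)] dc7 da5.
    by do ![split => //=].
  by exists s; split => //; apply: (ss (_, _)); rewrite /=; auto.
have [ka [k0 ks]] : exists ka : pl R, ka 0 = a1 /\ [/\ ka 2^-1 = k, ka (7 / 8) = a2 & ka 1 = l].
  have [|s [s0 ss]] := @plpaths R 0 2^-1 a1 k [:: (7 / 8, a2); (1, l)] dyad0 da1.
    have [h0 h1 h2] : [/\ 0 < 2^-1 :> R, 2^-1 < 7 / 8 :> R & 7 / 8 < 1 :> R] by split; order_lra.
    by do ![split => //=; try exact: dyad_half; try exact: dyad78; try exact: dyad1].
  by exists s; split => //; split; apply: (ss (_, _)); rewrite /=; auto.
case: ks => k1 k2 k3.
(* Any map from A1 to A2 serves: [P3] begins by undoing it, so that the square of [be] is [bb] on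
   A1. *)
have [b1 [b1c1 b1c2]] := plpath dc1 dc2 dc6 dc7 c12 c67.
have tk : pli tau (7 / 8) = 1 :> R by rewrite -tau_1 plK.
have t0 : pli tau 0 = 2^-1 :> R by rewrite -tau_half plK.
(* [bb] carries A1 to A3, and [P5] inserts [bump] on the way from A3 to A1 + 1. In the chart, the
   conjugate by [al] of the cube of [be] is then [bump_conj] on al(A1), and the conjugate by [be]
   after [al] is [bump] on [k, l]. *)
pose bb := plcomp al (plcomp (plinv s1) (plcomp ka (plcomp (plinv tau) (plcomp (plinv ka) al)))).
have bbE z : bb z = al (pli s1 (ka (pli tau (pli ka (al z))))) by [].
have bbc1 : bb c1 = a4 by rewrite bbE a1E -k0 plK t0 k1 -s1c4 plK a4E.
have bbc2 : bb c2 = a5 by rewrite bbE a2E -k2 plK tk k3 -s1c5 plK a5E.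
pose P3 := plcomp bb (plinv b1).
pose P5 := plcomp (plsh dyad1) (plcomp (plinv al) (plcomp ka (plcomp tau (plcomp bump
  (plcomp (plinv ka) (plcomp s1 (plinv al))))))).
pose P6 := plcomp (plsh dyad1) (plcomp (plinv s1) (plinv s2)).
have P3E z : P3 z = bb (pli b1 z) by [].
have P5E z : P5 z = pli al (ka (tau (bump (pli ka (s1 (pli al z)))))) + 1.
  exact: plshE.
have P6E z : P6 z = pli s1 (pli s2 z) + 1 by exact: plshE.
have P3c6 : P3 c6 = a4 by rewrite P3E -b1c1 plK.
have P3c7 : P3 c7 = a5 by rewrite P3E -b1c2 plK.
have P5a4 : P5 a4 = c1 + 1.
  by rewrite P5E -{1}a4E plK s1c4 -k1 plK bump_half tau_half k0 -a1E plK.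
have P5a5 : P5 a5 = c2 + 1.
  by rewrite P5E -{1}a5E plK s1c5 -k3 plK bump_1 tau_1 k2 -a2E plK.
have P6a5 : P6 a5 = c2 + 1 by rewrite P6E -s2c7 plK -s1c2 plK.
have P6c1 : P6 (c1 + 1) = c6 + 1 by rewrite P6E -s2a4 plK -s1c6 plK.
have [be [pbe [be1 be2 be3] [be4 be5 be6]]] : exists be : pl R, [/\ periodic be,
    [/\ forall z, c1 <= z <= c2 -> be z = b1 z,
        forall z, c2 <= z <= c6 -> be z = s1 z &
        forall z, c6 <= z <= c7 -> be z = P3 z] &
    [/\ forall z, c7 <= z <= a4 -> be z = s2 z,
        forall z, a4 <= z <= a5 -> be z = P5 z &
        forall z, a5 <= z <= c1 + 1 -> be z = P6 z]].
  have c26 : c2 < c6 by clear - c23 c34 c45 c56; order_lra.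
  have a5c : a5 < c1 + 1 by clear - a56 a67 a7x xc1; order_lra.
  clear - P3c6 P3c7 P5a4 P5a5 P6a5 P6c1 b1c1 b1c2 s1c2 s1c6 s2c7 s2a4 c12 c26 c67 c7a4 a45 a5c
    dc1 dc2 dc6 dc7 da4 da5.
  have [|Q1 [L1 R1]] := @plglue_ex R b1 s1 c2 dc2; first by rewrite b1c2 s1c2.
  have [|Q2 [L2 R2]] := @plglue_ex R Q1 P3 c6 dc6; first by rewrite R1 ?s1c6 ?P3c6//; order_lra.
  have [|Q3 [L3 R3]] := @plglue_ex R Q2 s2 c7 dc7; first by rewrite R2 ?P3c7 ?s2c7//; order_lra.
  have [|Q4 [L4 R4]] := @plglue_ex R Q3 P5 a4 da4; first by rewrite R3 ?s2a4 ?P5a4//; order_lra.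
  have [|Q5 [L5 R5]] := @plglue_ex R Q4 P6 a5 da5; first by rewrite R4 ?P5a5 ?P6a5//; order_lra.
  have [|be [pbe beE]] := @periodize R Q5 c1 dc1.
    by rewrite R5 ?P6c1 ?L5 ?L4 ?L3 ?L2 ?L1 ?b1c1//; order_lra.
  exists be; split => //; split => z /andP[z1 z2]; rewrite beE; try order_lra.
  - by rewrite L5 ?L4 ?L3 ?L2 ?L1//; order_lra.
  - by rewrite L5 ?L4 ?L3 ?L2 ?R1//; order_lra.
  - by rewrite L5 ?L4 ?L3 ?R2//; order_lra.
  - by rewrite L5 ?L4 ?R3//; order_lra.
  - by rewrite L5 ?R4//; order_lra.
  - by rewrite R5.
clear P3c6 P3c7 P5a4 P5a5 P6a5 P6c1.
exists be => // H gH Hal Hbe.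
pose g0 := plcomp (plsh (dyad_int (-1))) (plcomp be (plcomp be be)).
have g0E z : g0 z = be (be (be z)) - 1 by exact: (plshE (dyad_int (-1))).
have Hg0 : H g0 by do ?apply: plg_comp => //; exact: plg_int.
have pg0 : periodic g0 := plg_per gH Hg0.
pose gu := plcomp al (plcomp g0 (plinv al)).
have guE z : gu z = al (g0 (pli al z)) by [].
have Hgu : H gu by do ?apply: plg_comp => //; exact: plg_inv.
have pgu : periodic gu := plg_per gH Hgu.
pose gv := plcomp be (plcomp gu (plinv be)).
have gvE z : gv (be z) = be (gu z) by rewrite /gv /plcomp [LHS]/= plK.
have Hgv : H gv by do ?apply: plg_comp => //; exact: plg_inv.
clearbody g0 gu gv.
have s1I z : c2 <= z <= c6 -> c7 <= s1 z <= a4 by rewrite -s1c2 -s1c6 !pl_mono.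
have s2I z : c7 <= z <= a4 -> a5 <= s2 z <= c1 + 1 by rewrite -s2c7 -s2a4 !pl_mono.
have s1V z : c7 <= z <= a4 -> c2 <= pli s1 z <= c6.
  by move=> /andP[z1 z2]; apply/andP; split; rewrite -(pl_mono s1) pliK ?s1c2 ?s1c6.
have s2V z : a5 <= z <= c1 + 1 -> c7 <= pli s2 z <= a4.
  by move=> /andP[z1 z2]; apply/andP; split; rewrite -(pl_mono s2) pliK ?s2c7 ?s2a4.
have g0A z : c2 <= z <= c6 -> g0 z = z.
  move=> zz; rewrite g0E (be2 _ zz) (be4 _ (s1I _ zz)) (be6 _ (s2I _ (s1I _ zz))).
  by rewrite P6E !plK addrK.
have g0B z : c7 <= z <= a4 -> g0 z = z.
  move=> zz; rewrite g0E (be4 _ zz) (be6 _ (s2I _ zz)) P6E plK pbe.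
  by rewrite (be2 _ (s1V _ zz)) pliK addrK.
have g0C z : a5 <= z <= c1 + 1 -> g0 z = z.
  move=> zz; rewrite g0E (be6 _ zz) P6E pbe (be2 _ (s1V _ (s2V _ zz))) pliK pbe.
  by rewrite (be4 _ (s2V _ zz)) pliK addrK.
have guA z : a2 <= z <= a6 -> gu z = z.
  move=> /andP[z1 z2]; rewrite guE g0A ?pliK//.
  by apply/andP; split; rewrite -(pl_mono al) pliK ?a2E ?a6E.
have guB z : a7 <= z <= c4 + 1 -> gu z = z.
  move=> /andP[z1 z2]; rewrite guE g0B ?pliK//.
  by apply/andP; split; rewrite -(pl_mono al) pliK ?a7E// -a4E aal.
have guC z : c5 + 1 <= z <= a1 + 1 -> gu z = z.
  move=> /andP[z1 z2]; rewrite guE g0C ?pliK//.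
  by apply/andP; split; rewrite -(pl_mono al) pliK ?pal ?a1E// -a5E aal.
have wE y : 2^-1 <= y <= 1 -> c1 <= pli al (ka (tau y)) <= c2.
  move=> /tau_itv /andP[t1 t2]; apply/andP; split; rewrite -(pl_mono al) pliK.
    by rewrite a1E -k0 pl_mono.
  by rewrite a2E -k2 pl_mono.
have vE y : 2^-1 <= y <= 1 -> c4 <= pli s1 (ka y) <= c5.
  move=> /andP[t1 t2]; apply/andP; split; rewrite -(pl_mono s1) pliK.
    by rewrite s1c4 -k1 pl_mono.
  by rewrite s1c5 -k3 pl_mono.
have be13 y : 2^-1 <= y <= 1 -> be (be (pli al (ka (tau y)))) = al (pli s1 (ka y)).
  move=> yy; rewrite (be1 _ (wE _ yy)) be3 ?P3E ?plK ?bbE ?pliK ?plK//.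
  by rewrite -b1c1 -b1c2 !pl_mono; exact: wE.
have be5k y : 2^-1 <= y <= 1 -> be (al (pli s1 (ka y))) = pli al (ka (tau (bump y))) + 1.
  move=> yy; rewrite be5 ?P5E ?plK ?pliK ?plK//.
  by rewrite -a4E -a5E !pl_mono; exact: vE.
have gu3 y : 2^-1 <= y <= 1 -> gu (pli s1 (ka y)) = pli s1 (ka (bump y)).
  move=> yy; rewrite guE ali periodicB// periodicB// g0E (be5k _ yy) !pbe.
  by rewrite be13 ?addrK ?aal ?addrK//; exact: bump_itv.
have gvk y : 0 <= y <= 1 -> gv (ka y) = ka (bump y).
  move=> /andP[y1 y2]; have [yh|hy] := le_or_lt y 2^-1.
    have h1 : c3 <= pli s1 (ka y) by rewrite -(pl_mono s1) pliK s1c3 -k0 pl_mono.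
    have h2 : pli s1 (ka y) <= c4 by rewrite -(pl_mono s1) pliK s1c4 -k1 pl_mono.
    have h3 : c2 <= pli s1 (ka y) <= c6 by clear - h1 h2 c23 c45 c56; order_lra.
    rewrite bump_id; last by left.
    rewrite -{1}[ka y](pliK s1) -(be2 _ h3) gvE -[in LHS](addrK 1 (pli s1 (ka y))).
    rewrite periodicB// guB ?addrK ?(be2 _ h3) ?pliK//.
    by clear - h1 h2 c34 c23 c7x xa1 xc1 a12 a7x a67 c12; apply/andP; split; order_lra.
  have yy : 2^-1 <= y <= 1 by rewrite ltW.
  have I2 s : 2^-1 <= s <= 1 -> c2 <= pli s1 (ka s) <= c6.
    by move=> /vE /andP[h1 h2]; clear - h1 h2 c23 c34 c56; order_lra.
  rewrite -{1}[ka y](pliK s1) -(be2 _ (I2 _ yy)) gvE (gu3 _ yy).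
  by rewrite be2 ?pliK//; apply: I2; exact: bump_itv.
have guk y : 0 <= y <= 1 -> gu (ka y) = ka (bump_conj y).
  move=> /andP[y1 y2]; have [yh|hy] := le_or_lt y (7 / 8).
    have ss := @taui_itv _ y ltac:(clear - y1 yh; order_lra).
    rewrite -[y](pliK tau) bump_conj_tau guE g0E (be13 _ ss) (be5k _ ss) addrK pliK//.
  rewrite bump_conj_id; last by right; exact: ltW.
  have h1 : a2 <= ka y by rewrite -k2 pl_mono ltW.
  have h2 : ka y <= l by rewrite -k3 pl_mono.
  by rewrite guA//; clear - h1 h2 la4 a45 a56; order_lra.
have gab : good H (ka 0) (ka 1).
  apply: (model_good gH Hgv Hgu _ gvk guk); rewrite k0 k3.
    by clear - la4 a45 a56 a67 a7x xa1 xax; order_lra.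
  move=> z /andP[z1 z2].
  have [z6|z6] := le_or_lt z a6.
    by right; rewrite guA//; clear - z6 z1 a3l a23; order_lra.
  have [z7|z7] := le_or_lt z a7.
    left; have h1 : c7 <= pli s2 z.
      by rewrite -(pl_mono s2) pliK s2c7; clear - z6 a56; order_lra.
    have h2 : pli s2 z <= a1.
      by rewrite -(pl_mono s2) pliK s2a1; clear - z7 a7n; order_lra.
    have h3 : c7 <= pli s2 z <= a4 by clear - h1 h2 a12 a23 a34; order_lra.
    rewrite -{1}[z](pliK s2) -(be4 _ h3) gvE -[in LHS](addrK 1 (pli s2 z)).
    rewrite periodicB// guC ?addrK ?(be4 _ h3) ?pliK//.
    by clear - h1 h2 c56 c67; apply/andP; split; order_lra.
  have [zc4|zc4] := le_or_lt z (c4 + 1).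
    by right; rewrite guB// zc4 ltW.
  have [zc5|zc5] := le_or_lt z (c5 + 1).
    left; have h0 : c2 <= z - 1 <= c6 by clear - zc4 zc5 c23 c34 c56; order_lra.
    have h1 : nn <= s2 (s1 (z - 1)).
      rewrite -s2a1 pl_mono -s1c3 pl_mono; clear - zc4 c34; order_lra.
    have /andP[h2 h3] := s2I _ (s1I _ h0).
    rewrite -{1}[z](_ : be (s2 (s1 (z - 1))) = z); last by rewrite be6 ?h2// P6E !plK subrK.
    rewrite gvE guB; first by rewrite be6 ?h2// P6E !plK subrK.
    by clear - h1 h3 a7n c12 c23 c34; order_lra.
  by right; rewrite guC// z2 ltW.
have mvA z : c2 <= z <= c3 -> movable H (ka 0) (ka 1) z.
  move=> /andP[z1 z2]; apply: (@movable_step _ _ _ _ al) => //; apply: movable_id => //.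
  rewrite k0 k3; have h1 : a2 <= al z by rewrite -a2E pl_mono.
  have h2 : al z <= a3 by rewrite -a3E pl_mono.
  by clear - h1 h2 a12 a3l; order_lra.
have mvB z : c7 <= z <= a4 -> movable H (ka 0) (ka 1) z.
  move=> zz; have /andP[z1 z2] := zz; have [za|az] := le_or_lt z a1.
    apply: (@movable_stepV _ _ _ _ be) => //.
    rewrite -[z](pliK s1) -(be2 _ (s1V _ zz)) plK; apply: mvA.
    by apply/andP; split; rewrite -(pl_mono s1) pliK ?s1c2 ?s1c3.
  have [zl|lz] := lt_or_le z l; first by apply: movable_id; rewrite // k0 k3 az.
  (* What remains, [l, a4], goes by the inverse of [al] into ]c3, c4] and from there by [be] into
     ]a1, k], inside K. *)
  have h1 : c3 < pli al z by rewrite -(plS al) pliK a3E; clear - lz a3l; order_lra.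
  have h2 : pli al z <= c4 by rewrite -(pl_mono al) pliK a4E.
  apply: (@movable_stepV _ _ _ _ al) => //.
  apply: (@movable_step _ _ _ _ be) => //; rewrite be2; last first.
    by clear - h1 h2 c23 c45 c56; order_lra.
  apply: movable_id => //; rewrite k0 k3 -s1c3 plS h1 /=.
  apply: (@le_lt_trans _ _ k); first by rewrite -s1c4 pl_mono.
  by clear - ka2 a23 a3l; order_lra.
have mvC z : c2 <= z <= c6 -> movable H (ka 0) (ka 1) z.
  move=> zz; apply: (@movable_step _ _ _ _ be) => //; rewrite (be2 _ zz).
  exact/mvB/s1I.
have mvD z : a5 <= z <= c1 + 1 -> movable H (ka 0) (ka 1) z.
  move=> zz; apply: (@movable_step _ _ _ _ be) => //; rewrite (be6 _ zz) P6E.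
  by apply: movableB1 => //; exact/mvC/s1V/s2V.
apply: (cover_all gH gab) => z.
have [m /andP[z1 z2]] := int_translate z c1.
apply: (@movable_int _ _ _ _ _ m) => //; move: (z + m%:~R) z1 z2 => {}z z1 z2.
have [zc2|zc2] := le_or_lt z c2.
  apply: (@movable_step _ _ _ _ al) => //; apply: mvB.
  have h1 : a1 <= al z by rewrite -a1E pl_mono ltW.
  have h2 : al z <= a2 by rewrite -a2E pl_mono.
  by clear - h1 h2 c7x xa1 a23 a34; order_lra.
have [zc6|zc6] := le_or_lt z c6; first by apply: mvC; rewrite zc6 ltW.
have [zc7|zc7] := le_or_lt z c7.
  apply: (@movable_step _ _ _ _ al) => //; apply: mvD.
  have h1 : a6 <= al z by rewrite -a6E pl_mono ltW.
  have h2 : al z <= a7 by rewrite -a7E pl_mono.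
  by clear - h1 h2 a56 a7n nc1; order_lra.
have [za4|za4] := le_or_lt z a4; first by apply: mvB; rewrite za4 ltW.
have [za5|za5] := le_or_lt z a5; last by apply: mvD; rewrite z2 ltW.
apply: (@movable_stepV _ _ _ _ al) => //; apply: mvC.
have h1 : c4 <= pli al z by rewrite -(pl_mono al) pliK a4E ltW.
have h2 : pli al z <= c5 by rewrite -(pl_mono al) pliK a5E.
by clear - h1 h2 c23 c34 c56; order_lra.
Qed.

End Involution.

(** * Lifting Thompson maps to the line *)

Import numFieldNormedType.Exports.
Local Open Scope classical_set_scope.

Section Lifts.
Context {R : realType}.
Implicit Types (a b c d e x y t u v : R) (F G : pl R) (f g : circle R -> circle R).

Lemma proj_int (m : int) : proj (m%:~R : R) = 0.
Proof.
have : (m%:~R - 0 : R) \in integers R by rewrite subr0; exact: intr_int.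
by rewrite Quotient.idealrBE -proj0 => /eqP.
Qed.

Lemma proj_eqP x y : proj x = proj y <-> exists m : int, x = y + m%:~R.
Proof.
split=> [xyE|[m ->]]; last by rewrite projD proj_int addr0.
have : x - y \in integers R by rewrite Quotient.idealrBE; exact/eqP.
by move=> /intrP[m xym]; exists m; rewrite -xym addrC subrK.
Qed.

Lemma proj_repr (p : circle R) : proj (repr p) = p.
Proof. by rewrite /proj reprK. Qed.

Lemma projN x : proj (- x) = - proj x.
Proof. by apply: (@addIr _ (proj x)); rewrite -projD addNr addNr proj0. Qed.

Lemma proj_cell (p : circle R) a : exists2 x, a <= x < a + 1 & p = proj x.
Proof.
have [n] := floor_cell a (repr p) => /andP[h1 h2].
exists (repr p - n%:~R); first by apply/andP; split; order_lra.
by rewrite projD projN proj_int subr0 proj_repr.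
Qed.

Lemma dyadicE x : dyadic (proj x) <-> dyad x.
Proof.
split=> [[m [n /proj_eqP[k ->]]]|[m [n ->]]]; last by exists m, n.
by apply: dyadD; [exists m, n|exact: dyad_int].
Qed.

Lemma nearP (P : R -> Prop) : (\forall t \near (0 : R), P t) <->
  exists2 e, 0 < e & forall t, - e < t < e -> P t.
Proof.
split=> [/nbhs_ballP[e /= e0 eP]|[e e0 eP]].
  by exists e => // t te; apply: eP; rewrite /ball/= sub0r normrN ltr_norml.
apply/nbhs_ballP; exists e => // t; rewrite /ball/= sub0r normrN ltr_norml.
exact: eP.
Qed.

Definition lifts F f := forall t, f (proj t) = proj (F t).

Lemma pl_continuous F : continuous F.
Proof.
move=> x; have [e [a [c [b [d [e0 [pa _] [pb _] [Fl Fr] _]]]]]] := pl_germ F x.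
have a0 := pow2_gt0 pa; have b0 := pow2_gt0 pb.
have Fxl : F x = a * x + c by apply: Fl; apply/andP; split; order_lra.
have Fxr : F x = b * x + d by apply: Fr; apply/andP; split; order_lra.
apply/cvgrPdist_lt => eps eps0.
pose r := Num.min e (Num.min (eps / a) (eps / b)).
have r0 : 0 < r by rewrite !lt_min e0 !divr_gt0.
have r1 : r <= e by rewrite ge_min lexx.
have r2 : r <= eps / a by rewrite !ge_min lexx orbT.
have r3 : r <= eps / b by rewrite !ge_min lexx !orbT.
rewrite ler_pdivlMr// in r2; rewrite ler_pdivlMr// in r3.
apply/nbhs_ballP; exists r => //= t; rewrite /ball/= ltr_norml => /andP[t1 t2].
have [tx|xt] := le_or_lt t x.
  have Ft : F t = a * t + c by apply: Fl; apply/andP; split; order_lra.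
  have -> : F x - F t = a * (x - t) by rewrite Ft Fxl; ring.
  have xt0 : 0 <= x - t by rewrite subr_ge0.
  by rewrite ger0_norm ?mulr_ge0 ?(ltW a0)// (lt_le_trans _ r2)// mulrC ltr_pM2r.
have Ft : F t = b * t + d by apply: Fr; apply/andP; split; order_lra.
have -> : F x - F t = - (b * (t - x)) by rewrite Ft Fxr; ring.
have xt0 : 0 <= t - x by rewrite subr_ge0 ltW.
rewrite normrN ger0_norm ?mulr_ge0 ?(ltW b0)// (lt_le_trans _ r3)// mulrC ltr_pM2r//.
by order_lra.
Qed.

Lemma lift_map F : periodic F -> exists f, lifts F f.
Proof.
move=> pF; exists (fun p => proj (F (repr p))) => t.
have /proj_eqP[m ->] := proj_repr (proj t).
by apply/proj_eqP; exists m; exact: periodic_int.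
Qed.

Lemma lifts_continuous F f : lifts F f -> continuous f.
Proof.
move=> Ff; apply/quotient_continuous.
have -> : f \o \pi_(circle R)%qT = @proj R \o F by apply/funext => t; exact: Ff.
move=> x; apply: continuous_comp; first exact: pl_continuous.
exact: pi_continuous.
Qed.

Lemma aff_linear_near F f a c x e : lifts F f -> 0 < e ->
  (forall y, x - e < y < x + e -> F y = a * y + c) -> linear_near f (proj x) a.
Proof.
move=> Ff e0 FE; apply/nearP; exists e => // t /andP[t1 t2].
rewrite -projD !Ff !FE -?projD; first by congr proj; ring.
  by apply/andP; split; order_lra.
by apply/andP; split; order_lra.
Qed.

Lemma lifts_nonbreak F f x : lifts F f -> ~ dyad x -> exists a, linear_near f (proj x) a.
Proof.
move=> Ff dx; have [e [a [c [b [d [e0 _ _ [Fl Fr] Fx]]]]]] := pl_germ F x.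
case: Fx => [//|[ab cd]]; exists a; apply: (aff_linear_near Ff e0) => y /andP[y1 y2].
have [yx|xy] := le_or_lt y x; first by apply: Fl; rewrite y1.
by rewrite ab cd; apply: Fr; rewrite ltW.
Qed.

Lemma lifts_gradient F f p a : lifts F f -> linear_near f p a -> exists k : int, a = 2 ^ k.
Proof.
move=> Ff; rewrite -(proj_repr p); set x := repr p => fa.
have [e [_ [_ [b [d [e0 _ [pb _] [_ Fr] _]]]]]] := pl_germ F x.
have /nearP[e' e'0 fa'] := linear_near_shift fa.
(* The point x + t is interior to the right-hand piece of the germ, where the gradient is b; by
   [linear_near_shift] it is still a. *)
pose t := Num.min e e' / 2.
have m1 : Num.min e e' <= e by rewrite ge_min lexx.
have m2 : Num.min e e' <= e' by rewrite ge_min lexx orbT.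
have m0 : 0 < Num.min e e' by rewrite lt_min e0.
have t0 : 0 < t by rewrite divr_gt0.
have tE : t * 2 = Num.min e e' by rewrite /t divfK.
have fat : linear_near f (proj (x + t)) a.
  by rewrite projD; apply: fa'; clear - m2 t0 tE; lra.
have fbt : linear_near f (proj (x + t)) b.
  apply: (aff_linear_near Ff t0) => y /andP[y1 y2]; apply: Fr.
  by clear - y1 y2 t0 tE m1; apply/andP; split; lra.
by rewrite (linear_near_uniq fat fbt); exact: pb.
Qed.

(** By [pl_level], F is affine on the cells of some level N in [0, 1], so only the images of the
    cell endpoints can be breakpoints. *)
Lemma lifts_breakpoints F f : lifts F f -> finite_set (breakpoints f).
Proof.
move=> Ff; have [N /(_ N (leqnn _)) hN] := pl_level F (@ler01 R).
have N0 := exp2_gt0 N : 0 < 2 ^+ N :> R.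
apply: (@sub_finite_set _ _ ((fun i : nat => proj (i%:R / 2 ^+ N)) @` `I_(2 ^ N))); last first.
  by apply: finite_image; exact: finite_II.
move=> p pB; have [x /andP[x0 x1] pE] := proj_cell p 0; rewrite add0r in x1.
rewrite pE in pB *.
have X0 : 0 <= x * 2 ^+ N by rewrite mulr_ge0// ltW.
have /andP[i1 i2] := truncn_itv X0; set i := Num.truncn _ in i1 i2.
have iN : (i < 2 ^ N)%N.
  by rewrite -(ltr_nat R) natrX (le_lt_trans i1)// -[ltRHS]mul1r ltr_pM2r.
have [iE|ix] : i%:R = x * 2 ^+ N \/ i%:R < x * 2 ^+ N.
  by move: i1; rewrite le_eqVlt => /orP[/eqP|]; auto.
  by exists i => //; rewrite iE mulfK// gt_eqF.
exfalso; apply: pB.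
have [||a [c [pa dc hac]]] := hN i.
- by rewrite mul0r ler0n.
- by rewrite mul1r -natrX -[1]/(1%:R) -natrD ler_nat addn1.
exists a; pose e := Num.min (x * 2 ^+ N - i%:R) (i.+1%:R - x * 2 ^+ N).
have e0 : 0 < e / 2 ^+ N by rewrite divr_gt0// lt_min !subr_gt0 ix.
have m1 : e <= x * 2 ^+ N - i%:R by rewrite ge_min lexx.
have m2 : e <= i.+1%:R - x * 2 ^+ N by rewrite ge_min lexx orbT.
apply: (aff_linear_near Ff e0) => y /andP[y1 y2]; apply: hac.
rewrite ltrBlDr -(ltr_pM2r N0) mulrDl divfK ?gt_eqF// in y1.
rewrite -(ltr_pM2r N0) mulrDl divfK ?gt_eqF// in y2.
rewrite -natr1 in m2 *; rewrite -[i%:~R]/(i%:R).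
by clear - y1 y2 m1 m2; apply/andP; split; lra.
Qed.

Lemma lifts_inv F f g : lifts F f -> cancel f g -> lifts (plinv F) g.
Proof. by move=> Ff fg t; rewrite -{1}[t](pliK F) -Ff fg. Qed.

Lemma lifts_bij F f : lifts F f -> periodic F -> exists g, [/\ cancel f g, cancel g f & lifts (plinv F) g].
Proof.
move=> Ff pF; have [g Fg] := lift_map (periodic_inv pF).
exists g; split => // p; rewrite -(proj_repr p).
  by rewrite Ff Fg; congr proj; exact: plK.
by rewrite Fg Ff; congr proj; exact: pliK.
Qed.

Lemma lifts_dyadic F f : lifts F f -> f @` @dyadic R `<=` @dyadic R.
Proof.
move=> Ff _ [p + <-]; rewrite -(proj_repr p) Ff => /dyadicE dp.
by apply/dyadicE/pl_dyad.
Qed.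

Lemma lifts_thompson F f : lifts F f -> periodic F -> thompson_map f.
Proof.
move=> Ff pF; have [g [fg gf Gg]] := lifts_bij Ff pF; split.
- split; first exact: lifts_continuous Ff.
  by exists g; split => //; exact: lifts_continuous Gg.
- apply/seteqP; split; first exact: lifts_dyadic Ff.
  move=> p dp; exists (g p); last exact: gf.
  by apply: (lifts_dyadic Gg); exists p.
- exact: lifts_breakpoints Ff.
- by move=> p a; exact: lifts_gradient.
- move=> p; rewrite -(proj_repr p) => pB; apply/dyadicE; apply: contrapT => nd.
  exact/pB/(lifts_nonbreak Ff nd).
Qed.

End Lifts.

(** * Existence of lifts and transfer of generation to T *)

Section LiftExists.
Context {R : realType}.
Implicit Types (a b c d e x y t u v : R) (F G : pl R) (f g : circle R -> circle R).

Lemma dyadic_level (B : set (circle R)) : finite_set B -> B `<=` @dyadic R ->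
  exists N, forall x, B (proj x) -> exists j : int, x * 2 ^+ N = j%:~R.
Proof.
move=> /finite_seqP[s ->] sB.
suff [N hN] : exists N, forall M, (N <= M)%N -> forall x, proj x \in s -> exists j : int, x * 2 ^+ M = j%:~R.
  by exists N => x xs; exact: (hN N).
elim: s sB => [|p s IH] sB; first by exists 0%N.
have [|N1 h1] := IH; first by move=> q qs; apply: sB; rewrite /= inE qs orbT.
have : dyadic p by apply: sB; rewrite /= inE eqxx.
rewrite -(proj_repr p) => /dyadicE/dyad_exp2[N2 h2].
exists (maxn N1 N2) => M; rewrite geq_max => /andP[N1M N2M] x.
rewrite inE => /orP[/eqP|]; last exact: h1.
rewrite -(proj_repr p) => /proj_eqP[m ->]; have [j jE] := h2 _ N2M.
exists (j + m * 2 ^+ M); by rewrite proj_repr mulrDl jE intrD intrM rmorphXn.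
Qed.

(** Continuous induction: f has one gradient b on both sides of s, and b equals the gradient a
    already reached just before s. *)
Lemma linear_near_along f u v a : u <= v ->
  (forall x, u <= x <= v -> ~ breakpoints f (proj x)) -> linear_near f (proj u) a ->
  linear_near f (proj v) a /\ f (proj v) = f (proj u) + proj (a * (v - u)).
Proof.
move=> uv nb fa.
apply: (@real_ind R (fun x => linear_near f (proj x) a /\ f (proj x) = f (proj u) + proj (a * (x - u))) u v) => //.
  by rewrite subrr mulr0 proj0 addr0.
move=> s /nb/contrapT[b fb].
have [e1 e10 h1] := (nearP _).1 fb; have [e2 e20 h2] := (nearP _).1 (linear_near_shift fb).
have m1 : Num.min e1 e2 <= e1 by rewrite ge_min lexx.
have m2 : Num.min e1 e2 <= e2 by rewrite ge_min lexx orbT.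
exists (Num.min e1 e2) => [|x y ux sx xy ys yv [fx fxE]]; first by rewrite lt_min e10.
have h2' z : s - Num.min e1 e2 < z < s + Num.min e1 e2 -> linear_near f (proj z) b.
  move=> /andP[z1 z2]; rewrite -[z](subrK s) addrC projD; apply: h2.
  by clear - z1 z2 m2; apply/andP; split; lra.
have h1' z : s - Num.min e1 e2 < z < s + Num.min e1 e2 -> f (proj z) = f (proj s) + proj (b * (z - s)).
  move=> /andP[z1 z2]; rewrite -{1}[z](subrK s) addrC projD; apply: h1.
  by clear - z1 z2 m1; apply/andP; split; lra.
have Ix : s - Num.min e1 e2 < x < s + Num.min e1 e2 by rewrite sx (le_lt_trans xy).
have Iy : s - Num.min e1 e2 < y < s + Num.min e1 e2 by rewrite ys (lt_le_trans sx).
have ab := linear_near_uniq fx (h2' _ Ix); rewrite -ab in h1' h2'.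
split; first exact: h2'.
have := fxE; rewrite (h1' _ Ix) (h1' _ Iy) => /(congr1 (fun p => p + proj (a * (y - x)))).
rewrite -!addrA -!projD -!mulrDr => E.
rewrite (_ : y - s = x - s + (y - x)); last by ring.
by rewrite E; congr (_ + proj (_ * _)); ring.
Qed.

(** The preimage of the arc in the line is open, which is openness in the quotient topology. *)
Lemma nbhs_arc d e : 0 < e -> nbhs (proj d) [set q | exists2 s, `|s| < e & q = proj (d + s)].
Proof.
move=> e0; apply: open_nbhs_nbhs; split; last by exists 0; rewrite ?normr0 ?addr0.
have : open [set x : R | exists2 s, `|s| < e & proj x = proj (d + s)].
  rewrite openE => x [s se xE]; apply/nbhs_ballP; exists (e - `|s|) => /=; first by rewrite subr_gt0.
  move=> y; rewrite /ball/= distrC ltrBrDl => xy; exists (s + (y - x)).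
    exact: le_lt_trans (ler_normD _ _) xy.
  by rewrite addrA projD -xE -projD addrC subrK.
exact.
Qed.

Lemma closed_linear f a c t0 : continuous f ->
  (forall e, 0 < e -> exists2 t, `|t - t0| < e & f (proj t) = proj (a * t + c)) ->
  f (proj t0) = proj (a * t0 + c).
Proof.
move=> fc near0; set w := a * t0 + c.
(* The representative d lies within 1/2 of w, so the differences compared below stay under 1 and
   [proj_small] turns equalities on the circle into equalities on the line. *)
have [d /andP[d1 d2] fE] := proj_cell (f (proj t0)) (w - 2^-1).
have [dw|dw] := eqVneq d w; first by rewrite fE dw.
exfalso.
pose e := `|d - w| / 4.
have e0 : 0 < e by rewrite divr_gt0// normr_gt0 subr_eq0.
have dw2 : `|d - w| <= 2^-1 by rewrite ler_norml; clear - d1 d2; lra.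
have cfp : {for t0, continuous (f \o @proj R)}.
  by apply: continuous_comp; [exact: pi_continuous|exact: fc].
have := nbhs_arc d e0; rewrite -fE => /cfp/nbhs_ballP[r /= r0 hr].
have ap : 0 < `|a| + 1 by rewrite ltr_wpDl.
have [|t] := near0 (Num.min r (e / (`|a| + 1))); first by rewrite lt_min r0 divr_gt0.
rewrite lt_min => /andP[tr te] ftE.
have [|s se] := hr t; first by rewrite /ball/= distrC.
rewrite /= ftE => sE.
rewrite ltr_pdivlMr// mulrDr mulr1 in te.
have h : `|a * t + c - w| < e.
  rewrite (_ : a * t + c - w = (t - t0) * a); last by rewrite /w; ring.
  rewrite normrM; apply: le_lt_trans te; by rewrite lerDl.
have eE : e * 4 = `|d - w| by rewrite /e divfK.
have {}sE : a * t + c = d + s.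
  apply: proj_small sE.
  rewrite (_ : _ - _ = (a * t + c - w) - (d - w) - s); last by ring.
  have n1 := ler_normB (a * t + c - w - (d - w)) s.
  have n2 := ler_normB (a * t + c - w) (d - w).
  by clear - h se eE dw2 n1 n2; lra.
have : `|d - w| <= `|a * t + c - w| + `|s|.
  by rewrite (_ : d - w = (a * t + c - w) - s) ?ler_normB// sE; ring.
by clear - h se eE e0; lra.
Qed.

(** The open cell is reached from its midpoint by [linear_near_along]; the endpoints, which may be
    breakpoints, follow by continuity. *)
Lemma cell_linear f l r : thompson_map f -> l < r ->
  (forall x, l < x < r -> ~ breakpoints f (proj x)) ->
  exists a c, pow2 a /\ forall t, l <= t <= r -> f (proj t) = proj (a * t + c).
Proof.
move=> Tf lr nb; have [[fc _] _ _ fgrad _] := Tf.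
pose u := (l + r) / 2; have u1 : l < u by rewrite /u; lra.
have u2 : u < r by rewrite /u; lra.
clearbody u.
have [a fa] : exists a, linear_near f (proj u) a by apply: contrapT; apply: nb; rewrite u1.
have pa : pow2 a := fgrad _ _ fa.
exists a, (repr (f (proj u)) - a * u); split => //.
have inner t : l < t < r -> f (proj t) = proj (a * t + (repr (f (proj u)) - a * u)).
  move=> /andP[t1 t2].
  rewrite addrCA projD proj_repr -mulrBr.
  have [ut|tu] := le_or_lt u t.
    have [|||_ ->//] := @linear_near_along f u t a => // x /andP[x1 x2].
    by apply: nb; rewrite (lt_le_trans u1) ?(le_lt_trans x2).
  have [a' fa'] : exists a, linear_near f (proj t) a by apply: contrapT; apply: nb; rewrite t1.
  have [|||fa'' ->] := @linear_near_along f t u a' => //; first exact: ltW.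
    by move=> x /andP[x1 x2]; apply: nb; rewrite (lt_le_trans t1) ?(le_lt_trans x2).
  rewrite (linear_near_uniq fa'' fa) -addrA -projD.
  by rewrite (_ : a * _ + a * _ = 0) ?proj0 ?addr0//; ring.
move=> t /andP[t1 t2].
have [lt|tl] := lt_or_le l t; last first.
  apply: closed_linear => // e e0; exists (t + Num.min (e / 2) ((r - l) / 2)).
    rewrite addrC addKr ger0_norm ?le_min ?gt_min; first by apply/orP; left; lra.
    by apply/andP; split; lra.
  have m0 : 0 < Num.min (e / 2) ((r - l) / 2) by rewrite lt_min; apply/andP; split; lra.
  have m1 : Num.min (e / 2) ((r - l) / 2) <= (r - l) / 2 by rewrite ge_min lexx orbT.
  by apply: inner; apply/andP; split; lra.
have [tr|rt] := lt_or_le t r; first by apply: inner; rewrite lt.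
apply: closed_linear => // e e0; exists (t - Num.min (e / 2) ((r - l) / 2)).
  rewrite addrAC subrr sub0r normrN ger0_norm ?le_min ?gt_min; first by apply/orP; left; lra.
  by apply/andP; split; lra.
have m0 : 0 < Num.min (e / 2) ((r - l) / 2) by rewrite lt_min; apply/andP; split; lra.
have m1 : Num.min (e / 2) ((r - l) / 2) <= (r - l) / 2 by rewrite ge_min lexx orbT.
by apply: inner; apply/andP; split; lra.
Qed.

(** At a suitable level N all breakpoints are cell endpoints, so f is affine on each cell of [0, 1];
    a lift is glued cell by cell and then made periodic. *)
Theorem thompson_lift f : thompson_map f -> exists2 F, periodic F & lifts F f.
Proof.
move=> Tf; have [[_ [fi [_ fK _]]] fd fin _ fbd] := Tf.
have [N hN] := dyadic_level fin fbd.
have N0 := exp2_gt0 N : 0 < 2 ^+ N :> R.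
have dV : dyad ((2 ^+ N)^-1 : R) := pow2_dyad (pow2V (pow2X N)).
have [G GE] : exists G, forall t, 0 <= t <= 1 -> f (proj t) = proj (G t).
  suff [G GE] : exists G, forall t, 0 <= t <= (2 ^ N)%:R / 2 ^+ N -> f (proj t) = proj (G t).
    by exists G; rewrite natrX divff ?gt_eqF// in GE.
  elim: (2 ^ N)%N => [|n [G GE]].
    have : dyadic (f (proj 0)) by rewrite -fd; exists (proj 0) => //; exact/dyadicE/dyad0.
    rewrite -[f _]proj_repr => /dyadicE dc; exists (plsh dc) => t.
    by rewrite mul0r -eq_le => /eqP <-; rewrite plshE add0r proj_repr.
  have nn : n%:R / 2 ^+ N < n.+1%:R / 2 ^+ N :> R by rewrite ltr_pM2r ?invr_gt0// ltr_nat.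
  have [|a [c [pa ac]]] := cell_linear Tf nn.
    move=> x /andP[]; rewrite ltr_pdivrMr// ltr_pdivlMr// -(natr1 n) => x1 x2 /hN[j xj].
    have /(int_between j)/eqP : (n%:Z)%:~R < x * 2 ^+ N < (n%:Z)%:~R + 1
      by apply/andP; split; [exact: x1|exact: x2].
    by [].
  set tn := n%:R / 2 ^+ N in GE nn ac.
  have tn0 : 0 <= tn by rewrite divr_ge0// ltW.
  have dtn : dyad tn by apply: dyadM => //; exact: dyad_nat.
  (* The constant c from [cell_linear] matters modulo 1 only. This one is congruent to it, fits the
     value of G at tn, and is dyadic. *)
  have dc' : dyad (G tn - a * tn).
    by apply: dyadB; [exact/pl_dyad|apply: dyadM => //; exact: pow2_dyad].
  have [|G' [L' R']] := @plglue_ex R G (plaff pa dc') tn dtn; first by rewrite /= addrCA subrr addr0.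
  exists G' => t /andP[t0 t1]; have [tt|tt] := le_or_lt t tn.
    by rewrite L'// GE// t0.
  rewrite R' ?(ltW tt)// ac ?t1 ?(ltW tt)//=.
  have E : proj (G tn) = proj (a * tn + c) by rewrite -GE ?lexx ?tn0// ac// lexx ltW.
  have -> : a * t + (G tn - a * tn) = G tn + a * (t - tn) by ring.
  by rewrite [RHS]projD E -projD; congr proj; ring.
(* f has degree one: G 1 - G 0 is a positive integer, and if it exceeded 1, f would take its value
   at 0 again inside ]0, 1[. *)
have G1 : G 1 = G 0 + 1.
  have : proj (G 1) = proj (G 0).
    by rewrite -!GE ?lexx ?ler01//; congr f; rewrite (proj_int 1) proj0.
  move=> /proj_eqP[m mE].
  have : G 0 < G 1 by rewrite plS ltr01.
  rewrite mE ltrDl ltr0z => m0; congr (_ + _).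
  have [m1|m1] := ltP 1 m; last first.
    by have -> : m = 1 by apply/eqP; rewrite eq_le m1 -gtz0_ge1.
  exfalso; pose y := pli G (G 0 + 1).
  have y0 : 0 < y by rewrite -(plS G) pliK ltrDl.
  have y1 : y < 1 by rewrite -(plS G) pliK mE ltrD2l -[1]/(1%:~R) ltr_int.
  have : f (proj y) = f (proj 0).
    by rewrite !GE ?lexx ?ler01 ?ltW// pliK projD (proj_int 1) addr0.
  move=> /(can_inj fK)/proj_small y0E; rewrite subr0 gtr0_norm// in y0E.
  by rewrite y0E// ltxx in y0.
have [|F [pF FE]] := @periodize R G 0 (@dyad0 R); first by rewrite add0r.
exists F => // t; have [n /andP[n1 n2]] := floor_cell 0 t.
rewrite -[t](subrK n%:~R) projD proj_int addr0 periodic_int// projD proj_int addr0 FE ?GE//.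
  by apply/andP; split; lra.
by apply/andP; split; lra.
Qed.

Lemma generated_closed (G : groupType) (A : set G) : subgroup_closed (generated A).
Proof.
split=> [B [[]]//|x y gx gy B BA|x gx B BA].
  by have [[_ + _] _] := BA; apply; [exact: gx|exact: gy].
by have [[_ _ +] _] := BA; apply; exact: gx.
Qed.

Lemma generated_incl (G : groupType) (A : set G) : A `<=` generated A.
Proof. by move=> x Ax B [_]; exact. Qed.

Lemma val_thompson_inj (x y : thompsonT R) F : lifts F (val x) -> lifts F (val y) -> x = y.
Proof.
move=> Fx Fy; apply/val_inj/funext => p; rewrite -(proj_repr p).
exact: etrans (Fx _) (esym (Fy _)).
Qed.

Lemma generated_plgroup (A : set (thompsonT R)) :
  plgroup (fun F => periodic F /\ exists2 y, generated A y & lifts F (val y)).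
Proof.
have [g1 gM gV] := generated_closed A; split.
- move=> F G [pF [y gy Fy]] FG; split; first by move=> t; rewrite -!FG.
  by exists y => // t; rewrite -FG.
- move=> F G [pF [y gy Fy]] [pG [z gz Gz]]; split; first exact: periodic_comp.
  exists (y * z)%g; first exact: gM.
  by move=> t; rewrite [LHS]/= Gz Fy.
- move=> F [pF [y gy Fy]]; split; first exact: periodic_inv.
  exists (y^-1)%g; first exact: gV.
  exact: lifts_inv Fy (thompson_fun_invP y).1.
- split; first by move=> t; rewrite !plshE.
  by exists 1%g => // t; rewrite plshE projD (proj_int 1) addr0.
- by move=> F [].
Qed.

Lemma generate_from_lift (x : thompsonT R) al be : periodic al -> lifts al (val x) ->
  periodic be -> generates al be ->
  exists y : thompsonT R, generated [set x; y] = [set: thompsonT R].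
Proof.
move=> pal alx pbe gen; have [f bef] := lift_map pbe.
pose y : thompsonT R := SigSub (mem_set (lifts_thompson bef pbe)).
exists y; rewrite -subTset => z _.
have [F pF Fz] := thompson_lift (thompsonTP z).
have [_ [z' gz' Fz']] := gen _ (generated_plgroup [set x; y])
  (conj pal (ex_intro2 _ _ x (generated_incl (or_introl erefl)) alx))
  (conj pbe (ex_intro2 _ _ y (generated_incl (or_intror erefl)) bef)) F pF.
by rewrite (val_thompson_inj Fz Fz').
Qed.

End LiftExists.

Theorem corollary2 (R : realType) : three_halves_generated (thompsonT R).
Proof.
move=> x x1; have [F pF Fx] := thompson_lift (thompsonTP x).
have fixF t : (exists m : int, F t = t + m%:~R) -> val x (proj t) = proj t.
  by move=> [m E]; rewrite Fx E projD proj_int addr0.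
(* Removing the integer part of F t - t from the lift puts the displacement at t strictly between 0
   and 1, as t is moved. *)
have centre t : val x (proj t) <> proj t -> exists al : pl R,
    [/\ periodic al, lifts al (val x), t < al t & al t < t + 1].
  move=> xt; pose m := Num.floor (F t - t).
  have /andP[m1 m2] := floor_itv (F t - t); rewrite intrD in m2.
  have alE u : plcomp (plsh (dyad_int (- m))) F u = F u - m%:~R.
    by rewrite [LHS](plshE (dyad_int (- m))) rmorphN.
  exists (plcomp (plsh (dyad_int (- m))) F); split.
  - by move=> u; rewrite !alE pF addrAC.
  - by move=> u; rewrite alE Fx projD projN proj_int subr0.
  - rewrite alE lt_neqAle; apply/andP; split; last by rewrite /m; lra.
    by apply/eqP => E; apply: xt; apply: fixF; exists m; rewrite {2}E subrK.
  - by rewrite alE /m; lra.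
have [inv|ninv] := pselect (forall p, val x (val x p) = p).
  have [t xt] : exists t, val x (proj t) <> proj t.
    apply: contrapT => h; apply: x1; apply/val_inj/funext => p.
    by apply: contrapT => xp; apply: h; exists (repr p); rewrite proj_repr.
  have [al [pal alx ta at1]] := centre t xt.
  have aaE z : exists m : int, al (al z) = z + m%:~R.
    by apply/proj_eqP; rewrite -alx -alx inv.
  have aa1 z : 0 < al (al z) - z < 2 -> al (al z) = z + 1.
    have [m ->] := aaE z; rewrite addrC addKr => /andP[m0 m2].
    rewrite ltr0z in m0; rewrite -[2]/(2%:~R) ltr_int in m2.
    congr (_ + _); have -> // : m = 1.
    by apply/eqP; rewrite eq_le -gtz0_ge1 m0 andbT -ltzD1.
  have aat : al (al t) = t + 1.
    apply: aa1; have h1 : al t < al (al t) by rewrite plS.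
    have h2 : al (al t) < al (t + 1) by rewrite plS.
    by rewrite pal in h2; lra.
  (* The displacement of al^2 is an integer at each point. It is 1 at t, and monotonicity over one
     period keeps it strictly between 0 and 2. *)
  have aa z : al (al z) = z + 1.
    have pT : periodic (plsh (@dyad1 R)) by move=> u; rewrite !plshE.
    rewrite -(plshE dyad1); apply: (@periodic_ext _ (plcomp al al) _ t) => //.
      exact: periodic_comp.
    move=> u /andP[u1 u2]; rewrite plshE [LHS]/=; apply: aa1.
    have [ua|au] := le_or_lt u (al t).
      have h1 : al (al t) <= al (al u) by rewrite !pl_mono ltW.
      have h2 : al (al u) <= al (al (al t)) by rewrite !pl_mono.
      by rewrite aat pal in h2; rewrite aat in h1; lra.
    have h1 : al (al (al t)) <= al (al u) by rewrite !pl_mono ltW.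
    have h2 : al (al u) <= al (al (t + 1)) by rewrite !pl_mono.
    by rewrite aat pal in h1; rewrite !pal aat in h2; lra.
  have [be pbe gen] := generate_involution pal aa ta.
  exact: generate_from_lift pal alx pbe gen.
have [t xxt] : exists t, val x (val x (proj t)) <> proj t.
  apply: contrapT => h; apply: ninv => p.
  by apply: contrapT => xp; apply: h; exists (repr p); rewrite proj_repr.
have xt : val x (proj t) <> proj t by move=> E; apply: xxt; rewrite !E.
have [al [pal alx ta at1]] := centre t xt.
have aat : al (al t) != t + 1.
  by apply/eqP => E; apply: xxt; rewrite !alx E projD (proj_int 1) addr0.
have h1 : al t < al (al t) by rewrite plS.
have h2 : al (al t) < al t + 1 by rewrite -pal plS.
have [lt|le] := lt_or_le (al (al t)) (t + 1).
  have [be pbe gen] := generate_noninvolution pal ta h1 lt.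
  exact: generate_from_lift pal alx pbe gen.
have gt : t + 1 < al (al t) by rewrite lt_neqAle eq_sym aat.
(* When al^2 overshoots a full turn at t, the inverse, lifted so as to move forward, falls short of
   one; the inequalities hold at the base point al (al t). *)
pose al' := plcomp (plsh (@dyad1 R)) (plinv al).
have al'E u : al' u = pli al u + 1 by exact: plshE.
have pal' : periodic al' by move=> u; rewrite !al'E [pli al (u + 1)](periodic_inv pal).
have e1 : al' (al (al t)) = al t + 1 by rewrite al'E plK.
have e2 : al' (al' (al (al t))) = t + 2 by rewrite e1 -pal al'E plK; ring.
have g1 : al (al t) < al' (al (al t)) by rewrite e1.
have g2 : al' (al (al t)) < al' (al' (al (al t))) by rewrite plS.
have g3 : al' (al' (al (al t))) < al (al t) + 1 by rewrite e2; order_lra.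
have [be pbe gen] := generate_noninvolution pal' g1 g2 g3.
apply: (generate_from_lift pal alx pbe) => H gH Hal; apply: gen => //.
by apply: plg_comp => //; [exact: plg_sh|exact: plg_inv].
Qed.
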